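(* Let $G$ be a deterministic $d$-regular graph on $n$ vertices, let $\lambda_2$ be the second largest eigenvalue of $\frac1dA_G$ and $\lambda_n$ its smallest eigenvalue, and assume $\lambda_2<1$. Let $\varepsilon\in(0,1/2)$ and $\delta>0$. If $$\frac{d}{\log n}\ \ge\ 4\frac{1+|\lambda_n|}{(1-\lambda_2)^2}(1+\delta)\left[\frac{1}{(1-2\varepsilon)^2}+\frac13\frac{1-\lambda_2}{(1-2\varepsilon)(1+|\lambda_n|)}+\frac13\frac{1-\lambda_2}{1+|\lambda_n|}-1\right],$$ then with probability at least $1-n^{-\delta}$ the semidefinite program $\max\operatorname{Tr}(WX)$ s.t. $X\succeq0$, $X_{ii}=1\ \forall i$, has $gg^T$ as its unique optimal solution, where $g_i=(-1)^{x_i}$. As $\varepsilon\to1/2$ the condition can be written $\frac{d}{\log n}\ge4\frac{1+|\lambda_n|}{(1-\lambda_2)^2}(1+\delta)\left[\frac{1}{(1-2\varepsilon)^2}+o\!\left(\frac{1}{(1-2\varepsilon)^2}\right)\right]$, and if moreover $\lambda_2=o(1)$ and $|\lambda_n|=o(1)$ it reads $\frac{d}{\log n}\ge\frac{4(1+\delta)}{(1-2\varepsilon)^2}+o\!\left(\frac{1}{(1-2\varepsilon)^2}\right)$.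
   Context: Model: $G=(V,E)$, $V=[n]$, with adjacency matrix $A_G$; unknown $x\in\{0,1\}^n$; for each edge $(i,j)$ one observes $Y_{(i,j)}=x_i\oplus x_j\oplus Z_{(i,j)}$ (mod 2) with $Z_{(i,j)}$ i.i.d. Bernoulli$(\varepsilon)$. $W\in\mathbb{R}^{n\times n}$ has $W(i,j)=(-1)^{Y_{(i,j)}}$ if $(i,j)\in E$ and $0$ otherwise. Equivalently $\lambda_2=\frac1d\max_{x\perp\mathbf 1}\frac{x^TA_Gx}{x^Tx}$ and $|\lambda_n|=\frac1d\max_{x\perp\mathbf 1}\left(-\frac{x^TA_Gx}{x^Tx}\right)$. Logarithms are natural. *)

(* Defs.v *)
From Stdlib Require Import Reals List Arith Lia ClassicalEpsilon.
Import ListNotations.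
Open Scope R_scope.

Fixpoint rsum (n : nat) (f : nat -> R) : R :=
  match n with O => 0 | S k => rsum k f + f k end.

Definition simple_regular (n d : nat) (a : nat -> nat -> bool) : Prop :=
  (forall i j, a i j = a j i) /\
  (forall i, a i i = false) /\
  (forall i j, a i j = true -> (i < n)%nat /\ (j < n)%nat) /\
  (forall i, (i < n)%nat -> length (filter (fun j => a i j) (seq 0 n)) = d).

Definition adjR (a : nat -> nat -> bool) (i j : nat) : R := if a i j then 1 else 0.

Definition quad (n : nat) (M : nat -> nat -> R) (v : nat -> R) : R :=
  rsum n (fun i => rsum n (fun j => v i * M i j * v j)).

Definition sqnorm (n : nat) (v : nat -> R) : R := rsum n (fun i => v i * v i).

Definition rayleigh_set (n d : nat) (a : nat -> nat -> bool) (r : R) : Prop :=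
  exists v : nat -> R, rsum n v = 0 /\ sqnorm n v <> 0 /\
    r = / INR d * (quad n (adjR a) v / sqnorm n v).

Definition IsMax (S : R -> Prop) (m : R) : Prop := S m /\ forall y, S y -> y <= m.

Definition is_lambda2 (n d : nat) (a : nat -> nat -> bool) (l : R) : Prop :=
  IsMax (rayleigh_set n d a) l.

Definition is_abs_lambdan (n d : nat) (a : nat -> nat -> bool) (l : R) : Prop :=
  IsMax (fun r => rayleigh_set n d a (- r)) l.

Definition edges (n : nat) (a : nat -> nat -> bool) : list (nat * nat) :=
  filter (fun p => andb (Nat.ltb (fst p) (snd p)) (a (fst p) (snd p)))
         (list_prod (seq 0 n) (seq 0 n)).

(* W(i,j) = (-1)^{Y_(i,j)} for edges, 0 otherwise, where
   Y_(u,v) = x_u xor x_v xor Z_(u,v); zs lists the noise bits Z_e in the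
   order of the edge list E. *)
Definition W_of (E : list (nat * nat)) (x : nat -> bool) (zs : list bool)
  (i j : nat) : R :=
  fold_right
    (fun (pz : (nat * nat) * bool) acc =>
       let '((u, v), z) := pz in
       if orb (andb (Nat.eqb u i) (Nat.eqb v j)) (andb (Nat.eqb u j) (Nat.eqb v i))
       then (if xorb (xorb (x u) (x v)) z then -1 else 1) + acc
       else acc)
    0 (combine E zs).

Fixpoint blists (m : nat) : list (list bool) :=
  match m with
  | O => cons (@nil bool) nil
  | S k => map (cons true) (blists k) ++ map (cons false) (blists k)
  end.

(* probability of a noise pattern under i.i.d. Bernoulli(eps) *)
Definition weight (eps : R) (zs : list bool) : R :=
  fold_right (fun (b : bool) (acc : R) => (if b then eps else 1 - eps) * acc) 1 zs.

Definition prob (n : nat) (a : nat -> nat -> bool) (eps : R)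
  (P : list bool -> Prop) : R :=
  fold_right
    (fun (zs : list bool) (acc : R) =>
       (if excluded_middle_informative (P zs) then weight eps zs else 0) + acc)
    0 (blists (length (edges n a))).

Definition sdp_feasible (n : nat) (X : nat -> nat -> R) : Prop :=
  (forall i j, (i < n)%nat -> (j < n)%nat -> X i j = X j i) /\
  (forall v : nat -> R, 0 <= quad n X v) /\
  (forall i, (i < n)%nat -> X i i = 1).

Definition trace_prod (n : nat) (W X : nat -> nat -> R) : R :=
  rsum n (fun i => rsum n (fun j => W i j * X j i)).

Definition sdp_unique_opt (n : nat) (W X0 : nat -> nat -> R) : Prop :=
  sdp_feasible n X0 /\
  forall X, sdp_feasible n X ->
    trace_prod n W X <= trace_prod n W X0 /\
    (trace_prod n W X = trace_prod n W X0 ->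
       forall i j, (i < n)%nat -> (j < n)%nat -> X i j = X0 i j).

Definition gvec (x : nat -> bool) (i : nat) : R := if x i then -1 else 1.

(* Main.v *)
(** Write [L_e] for the Laplacian of the single edge [e].  If the signed Laplacian
    [sum_e (1 - 2 Z_e) L_e] is positive definite on the orthogonal complement of the constants, then
    a Gram decomposition of a feasible [X] expresses the gap between the objective at [g g^T] and at
    [X] as a sum of values of this form, so that [g g^T] is the unique optimum.

    Failure of positivity is controlled by a matrix Bernstein inequality.  Each summand being a
    random multiple of a fixed rank-one projection [u u^T], neither Lieb's theorem nor
    Golden-Thompson is needed.  For [f c = sum_(k < K) tr ((M + c u u^T)^k) / k!] with [M]
    semidefinite, the moments [m_k = u^T (M + c u u^T)^k u] form a log-convex sequence, hence
    [m_i m_j <= m_(i+j)], hence [f'' <= f'], and [f] is a concave function of [exp c].  By Jensen's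
    inequality the expectation passes through one edge at a time.  The truncation at [K] means that
    only the scalar exponential series is ever passed to the limit. *)

Require Import Defs.
From Coquelicot Require Import Coquelicot.
From Stdlib Require Import Reals List Arith Lia Lra ClassicalEpsilon.
Import ListNotations.
Open Scope R_scope.

(** * Finite sums *)

Definition lsum {A : Type} (l : list A) (f : A -> R) : R :=
  fold_right (fun a acc => f a + acc) 0 l.

Lemma lsum_ext {A} (l : list A) f g : (forall a, In a l -> f a = g a) -> lsum l f = lsum l g.
Proof.
  induction l as [|b l IH]; simpl; intros H; [reflexivity|]; rewrite IH, H; auto.
Qed.

Lemma lsum_le {A} (l : list A) f g : (forall a, In a l -> f a <= g a) -> lsum l f <= lsum l g.
Proof.
  induction l as [|b l IH]; simpl; intros H; [lra|].
  apply Rplus_le_compat; auto.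
Qed.

Lemma lsum_plus {A} (l : list A) f g : lsum l (fun a => f a + g a) = lsum l f + lsum l g.
Proof. induction l as [|b l IH]; simpl; [|rewrite IH]; ring. Qed.

Lemma lsum_scal {A} (l : list A) c f : lsum l (fun a => c * f a) = c * lsum l f.
Proof. induction l as [|b l IH]; simpl; [|rewrite IH]; ring. Qed.

Lemma lsum_minus {A} (l : list A) f g : lsum l (fun a => f a - g a) = lsum l f - lsum l g.
Proof. induction l as [|b l IH]; simpl; [|rewrite IH]; ring. Qed.

Lemma lsum_const {A} (l : list A) c : lsum l (fun _ => c) = INR (length l) * c.
Proof.
  induction l as [|b l IH]; [simpl; ring|].
  simpl length; rewrite S_INR; simpl lsum; rewrite IH; ring.
Qed.

Lemma lsum_eq0 {A} (l : list A) f : (forall a, In a l -> f a = 0) -> lsum l f = 0.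
Proof. intros H; rewrite (lsum_ext l f (fun _ => 0)) by auto; rewrite lsum_const; ring. Qed.

Lemma lsum_swap {A B} (l : list A) (m : list B) f :
  lsum l (fun a => lsum m (fun b => f a b)) = lsum m (fun b => lsum l (fun a => f a b)).
Proof.
  induction l as [|c l IH]; simpl; [symmetry; apply lsum_eq0; auto|].
  rewrite IH, <- lsum_plus; reflexivity.
Qed.

Lemma lsum_app {A} (l m : list A) f : lsum (l ++ m) f = lsum l f + lsum m f.
Proof. induction l as [|b l IH]; simpl; [|rewrite IH]; ring. Qed.

Lemma lsum_map {A B} (h : A -> B) l f : lsum (map h l) f = lsum l (fun a => f (h a)).
Proof. induction l as [|b l IH]; simpl; [|rewrite IH]; reflexivity. Qed.

Lemma lsum_filter {A} (b : A -> bool) l f :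
  lsum (filter b l) f = lsum l (fun a => if b a then f a else 0).
Proof.
  induction l as [|c l IH]; simpl; [reflexivity|].
  destruct (b c); simpl; rewrite IH; ring.
Qed.

Lemma lsum_list_prod {A B} (l : list A) (m : list B) f :
  lsum (list_prod l m) f = lsum l (fun a => lsum m (fun b => f (a, b))).
Proof.
  induction l as [|c l IH]; simpl; [reflexivity|].
  rewrite lsum_app, lsum_map, IH; reflexivity.
Qed.

Lemma lsum_combine_fst {A B} (l : list A) (m : list B) f : length m = length l ->
  lsum (combine l m) (fun p => f (fst p)) = lsum l f.
Proof.
  revert m; induction l as [|a l IH]; intros [|b m] H; simpl in *; try lia; try reflexivity.
  rewrite IH; auto.
Qed.

Lemma lsum_combine_map_l {A B C} (h : A -> B) (l : list A) (m : list C) f :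
  lsum (combine (map h l) m) f = lsum (combine l m) (fun p => f (h (fst p), snd p)).
Proof.
  revert m; induction l as [|a l IH]; intros [|c m]; simpl; try reflexivity.
  rewrite IH; reflexivity.
Qed.

Lemma rsum_lsum n f : rsum n f = lsum (seq 0 n) f.
Proof.
  induction n as [|n IH]; [reflexivity|].
  rewrite seq_S, lsum_app, <- IH; simpl; ring.
Qed.

Lemma rsum_ext n f g : (forall i, (i < n)%nat -> f i = g i) -> rsum n f = rsum n g.
Proof.
  intros H; rewrite !rsum_lsum; apply lsum_ext; intros i Hi.
  apply in_seq in Hi; apply H; lia.
Qed.

Lemma rsum_le n f g : (forall i, (i < n)%nat -> f i <= g i) -> rsum n f <= rsum n g.
Proof.
  intros H; rewrite !rsum_lsum; apply lsum_le; intros i Hi.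
  apply in_seq in Hi; apply H; lia.
Qed.

Lemma rsum_plus n f g : rsum n (fun i => f i + g i) = rsum n f + rsum n g.
Proof. rewrite !rsum_lsum; apply lsum_plus. Qed.

Lemma rsum_minus n f g : rsum n (fun i => f i - g i) = rsum n f - rsum n g.
Proof. rewrite !rsum_lsum; apply lsum_minus. Qed.

Lemma rsum_scal n c f : rsum n (fun i => c * f i) = c * rsum n f.
Proof. rewrite !rsum_lsum; apply lsum_scal. Qed.

Lemma rsum_scal_r n c f : rsum n (fun i => f i * c) = rsum n f * c.
Proof. rewrite Rmult_comm, <- rsum_scal; apply rsum_ext; intros; ring. Qed.

Lemma rsum_const n c : rsum n (fun _ => c) = INR n * c.
Proof. rewrite rsum_lsum, lsum_const, length_seq; reflexivity. Qed.

Lemma rsum_eq0 n f : (forall i, (i < n)%nat -> f i = 0) -> rsum n f = 0.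
Proof. intros H; rewrite (rsum_ext n f (fun _ => 0)) by auto; rewrite rsum_const; ring. Qed.

Lemma rsum_nonneg n f : (forall i, (i < n)%nat -> 0 <= f i) -> 0 <= rsum n f.
Proof. intros H; rewrite <- (rsum_eq0 n (fun _ => 0)) by auto; apply rsum_le; auto. Qed.

Lemma rsum_swap n m f :
  rsum n (fun i => rsum m (fun j => f i j)) = rsum m (fun j => rsum n (fun i => f i j)).
Proof.
  rewrite !rsum_lsum.
  rewrite (lsum_ext (seq 0 n) _ (fun i => lsum (seq 0 m) (f i))) by (intros; apply rsum_lsum).
  rewrite lsum_swap; apply lsum_ext; intros; symmetry; apply rsum_lsum.
Qed.

Lemma lsum_rsum_swap {A} (l : list A) n f :
  lsum l (fun a => rsum n (f a)) = rsum n (fun k => lsum l (fun a => f a k)).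
Proof.
  rewrite rsum_lsum, <- lsum_swap; apply lsum_ext; intros; apply rsum_lsum.
Qed.

Lemma rsum_S_l n f : rsum (S n) f = f 0%nat + rsum n (fun i => f (S i)).
Proof.
  rewrite !rsum_lsum; simpl seq; rewrite <- seq_shift; simpl; rewrite lsum_map; reflexivity.
Qed.

Lemma rsum_nonneg_eq0 n f :
  (forall i, (i < n)%nat -> 0 <= f i) -> rsum n f = 0 ->
  forall i, (i < n)%nat -> f i = 0.
Proof.
  induction n as [|n IH]; simpl; intros H H0 i Hi; [lia|].
  assert (0 <= rsum n f) by (apply rsum_nonneg; auto).
  assert (0 <= f n) by auto.
  destruct (Nat.eq_dec i n) as [->|]; [lra|].
  apply IH; [auto|lra|lia].
Qed.

(** * Vectors and matrices *)

Definition unitv (l i : nat) : R := if Nat.eqb i l then 1 else 0.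

Definition dot (n : nat) (x y : nat -> R) : R := rsum n (fun i => x i * y i).

Definition mulmv (n : nat) (M : nat -> nat -> R) (v : nat -> R) (i : nat) : R :=
  rsum n (fun j => M i j * v j).

Lemma dot_comm n x y : dot n x y = dot n y x.
Proof. apply rsum_ext; intros; ring. Qed.

Lemma dot_ext_r n x y z : (forall i, (i < n)%nat -> y i = z i) -> dot n x y = dot n x z.
Proof. intros H; apply rsum_ext; intros; rewrite H; auto. Qed.

Lemma dot_linear_r n a b x y z :
  dot n z (fun i => a * x i + b * y i) = a * dot n z x + b * dot n z y.
Proof. unfold dot; rewrite <- !rsum_scal, <- rsum_plus; apply rsum_ext; intros; ring. Qed.

Lemma dot_linear_l n a b x y z :
  dot n (fun i => a * x i + b * y i) z = a * dot n x z + b * dot n y z.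
Proof. rewrite dot_comm, dot_linear_r, !(dot_comm n z); reflexivity. Qed.

Lemma dot_unitv n l x : (l < n)%nat -> dot n (unitv l) x = x l.
Proof.
  intros Hl; unfold dot; induction n as [|n IH]; [lia|]; simpl; unfold unitv at 2.
  destruct (Nat.eqb_spec n l) as [->|]; [|rewrite IH by lia; ring].
  rewrite rsum_eq0; [ring|]; intros i Hi; unfold unitv.
  destruct (Nat.eqb_spec i l); [lia|ring].
Qed.

Lemma sqnorm_dot n x : sqnorm n x = dot n x x.
Proof. reflexivity. Qed.

Lemma sqnorm_nonneg n x : 0 <= sqnorm n x.
Proof. apply rsum_nonneg; intros; nra. Qed.

Lemma sqnorm_eq0 n v : sqnorm n v = 0 -> forall i, (i < n)%nat -> v i = 0.
Proof.
  intros H i Hi; assert (v i * v i = 0); [|nra].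
  apply (rsum_nonneg_eq0 n (fun i => v i * v i)); auto; intros; nra.
Qed.

Lemma sqnorm_unitv n l : (l < n)%nat -> sqnorm n (unitv l) = 1.
Proof.
  intros H; rewrite sqnorm_dot, dot_unitv by auto; unfold unitv.
  rewrite Nat.eqb_refl; reflexivity.
Qed.

Lemma mulmv_ext n M N x y i :
  (forall j, (j < n)%nat -> M i j = N i j) -> (forall j, (j < n)%nat -> x j = y j) ->
  mulmv n M x i = mulmv n N y i.
Proof. intros HM Hx; apply rsum_ext; intros; rewrite HM, Hx; auto. Qed.

Lemma mulmv_linear n M a b x y i :
  mulmv n M (fun j => a * x j + b * y j) i = a * mulmv n M x i + b * mulmv n M y i.
Proof. apply (dot_linear_r n a b x y (M i)). Qed.

Lemma mulmv_unitv n M k i : (k < n)%nat -> mulmv n M (unitv k) i = M i k.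
Proof.
  intros Hk; change (dot n (M i) (unitv k) = M i k).
  rewrite dot_comm; apply dot_unitv; auto.
Qed.

Lemma quad_dot n M v : quad n M v = dot n v (mulmv n M v).
Proof.
  apply rsum_ext; intros; unfold mulmv; rewrite <- rsum_scal.
  apply rsum_ext; intros; ring.
Qed.

Lemma quad_ext n M N v :
  (forall i j, (i < n)%nat -> (j < n)%nat -> M i j = N i j) -> quad n M v = quad n N v.
Proof. intros H; apply rsum_ext; intros; apply rsum_ext; intros; rewrite H; auto. Qed.

Lemma quad_unitv n M k : (k < n)%nat -> quad n M (unitv k) = M k k.
Proof. intros Hk; rewrite quad_dot, dot_unitv by auto; apply mulmv_unitv; auto. Qed.

Lemma quad_outer n u v : quad n (fun i j => u i * u j) v = dot n u v ^ 2.
Proof.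
  simpl; rewrite Rmult_1_r; unfold quad, dot; rewrite <- rsum_scal_r.
  apply rsum_ext; intros; rewrite <- rsum_scal; apply rsum_ext; intros; ring.
Qed.

(** * Positive semidefinite matrices *)

Definition sym_mx (n : nat) (M : nat -> nat -> R) : Prop :=
  forall i j, (i < n)%nat -> (j < n)%nat -> M i j = M j i.

Definition psd (n : nat) (M : nat -> nat -> R) : Prop :=
  sym_mx n M /\ forall v, 0 <= quad n M v.

Lemma dot_mulmv_adj n M x y : sym_mx n M -> dot n x (mulmv n M y) = dot n (mulmv n M x) y.
Proof.
  intros HM; unfold dot, mulmv.
  transitivity (rsum n (fun i => rsum n (fun j => x i * M i j * y j))).
  { apply rsum_ext; intros; rewrite <- rsum_scal; apply rsum_ext; intros; ring. }
  rewrite rsum_swap; apply rsum_ext; intros j Hj.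
  rewrite <- rsum_scal_r; apply rsum_ext; intros i Hi; rewrite (HM i j) by auto; ring.
Qed.

Lemma quad_lincomb n M a b x y : sym_mx n M ->
  quad n M (fun i => a * x i + b * y i) =
  a ^ 2 * quad n M x + 2 * a * b * dot n x (mulmv n M y) + b ^ 2 * quad n M y.
Proof.
  intros HM; rewrite !quad_dot.
  rewrite (dot_ext_r n _ _ (fun i => a * mulmv n M x i + b * mulmv n M y i))
    by (intros; apply mulmv_linear).
  rewrite dot_linear_r, !dot_linear_l.
  rewrite (dot_mulmv_adj n M y x), (dot_comm n (mulmv n M y) x) by auto; ring.
Qed.

Lemma discriminant_nonpos A B C : 0 <= A ->
  (forall t s, 0 <= t ^ 2 * A + 2 * t * s * B + s ^ 2 * C) -> B ^ 2 <= A * C.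
Proof.
  intros [HA|<-] H.
  - specialize (H (- B) A); apply Rmult_le_reg_l with A; nra.
  - destruct (Req_dec B 0) as [->|HB]; [lra|].
    specialize (H (- (C + 1) / (2 * B)) 1).
    replace ((- (C + 1) / (2 * B)) ^ 2 * 0 + 2 * (- (C + 1) / (2 * B)) * 1 * B + 1 ^ 2 * C)
      with (-1) in H by (field; auto).
    lra.
Qed.

Lemma psd_cauchy_schwarz n M x y : psd n M ->
  dot n x (mulmv n M y) ^ 2 <= quad n M x * quad n M y.
Proof.
  intros [Hs Hp]; apply discriminant_nonpos; [apply Hp|].
  intros t s; rewrite <- quad_lincomb by auto; apply Hp.
Qed.

Lemma psd_diag_nonneg n M k : psd n M -> (k < n)%nat -> 0 <= M k k.
Proof. intros [_ Hp] Hk; rewrite <- (quad_unitv n) by auto; apply Hp. Qed.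

Lemma psd_diag_eq0 n M i k : psd n M -> (i < n)%nat -> (k < n)%nat ->
  M k k = 0 -> M i k = 0.
Proof.
  intros HM Hi Hk H0.
  assert (C := psd_cauchy_schwarz n M (unitv i) (unitv k) HM).
  rewrite dot_unitv, mulmv_unitv, !quad_unitv, H0 in C by auto; nra.
Qed.

Lemma psd_sqnorm_mulmv_le n M b w : psd n M -> 0 <= b ->
  (forall v, quad n M v <= b * sqnorm n v) -> sqnorm n (mulmv n M w) <= b * quad n M w.
Proof.
  intros HM Hb Hquad.
  assert (C := psd_cauchy_schwarz n M (mulmv n M w) w HM); rewrite <- sqnorm_dot in C.
  assert (Q := Hquad (mulmv n M w)); assert (P := proj2 HM w).
  assert (N := sqnorm_nonneg n (mulmv n M w)).
  destruct (Req_dec (sqnorm n (mulmv n M w)) 0) as [->|]; [nra|].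
  apply Rmult_le_reg_l with (sqnorm n (mulmv n M w)); nra.
Qed.

Definition scalar_mx (s : R) (i j : nat) : R := s * unitv j i.

Lemma sym_scalar_mx n s : sym_mx n (scalar_mx s).
Proof. intros i j _ _; unfold scalar_mx, unitv; rewrite Nat.eqb_sym; reflexivity. Qed.

Lemma mulmv_scalar_mx n s v i : (i < n)%nat -> mulmv n (scalar_mx s) v i = s * v i.
Proof.
  intros Hi; rewrite <- (dot_unitv n i v) by auto; unfold mulmv, dot; rewrite <- rsum_scal.
  apply rsum_ext; intros j _; unfold scalar_mx, unitv; rewrite Nat.eqb_sym; ring.
Qed.

Lemma quad_scalar_mx n s v : quad n (scalar_mx s) v = s * sqnorm n v.
Proof.
  rewrite quad_dot; unfold sqnorm; rewrite <- rsum_scal.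
  apply rsum_ext; intros i Hi; rewrite mulmv_scalar_mx by auto; ring.
Qed.

Lemma dot_cauchy_schwarz n x y : dot n x y ^ 2 <= sqnorm n x * sqnorm n y.
Proof.
  assert (C : psd n (scalar_mx 1)).
  { split; [apply sym_scalar_mx|intros v; rewrite quad_scalar_mx].
    assert (N := sqnorm_nonneg n v); lra. }
  apply (psd_cauchy_schwarz n _ x y) in C; rewrite !quad_scalar_mx, !Rmult_1_l in C.
  rewrite (dot_ext_r n x _ y) in C; auto.
  intros; rewrite mulmv_scalar_mx by auto; ring.
Qed.

(** * Rank-one updates and Gram decompositions *)

Definition rank1 (M : nat -> nat -> R) (u : nat -> R) (c : R) (i j : nat) : R :=
  M i j + c * (u i * u j).

Lemma mulmv_rank1 n M u c x i :
  mulmv n (rank1 M u c) x i = 1 * mulmv n M x i + c * dot n u x * u i.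
Proof.
  unfold mulmv, rank1, dot; rewrite Rmult_1_l, Rmult_assoc.
  rewrite <- rsum_scal_r, <- rsum_scal, <- rsum_plus; apply rsum_ext; intros; ring.
Qed.

Lemma quad_rank1 n M u c v : quad n (rank1 M u c) v = quad n M v + c * dot n u v ^ 2.
Proof.
  rewrite !quad_dot, (dot_ext_r n v _ _ (fun i _ => mulmv_rank1 n M u c v i)).
  rewrite dot_linear_r, (dot_comm n v u); ring.
Qed.

Lemma sym_rank1 n M u c : sym_mx n M -> sym_mx n (rank1 M u c).
Proof. intros H i j Hi Hj; unfold rank1; rewrite (H i j) by auto; ring. Qed.

Lemma psd_rank1 n M u c : psd n M -> 0 <= c -> psd n (rank1 M u c).
Proof.
  intros [Hs Hp] Hc; split; [apply sym_rank1; auto|].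
  intros v; rewrite quad_rank1; specialize (Hp v).
  assert (0 <= dot n u v ^ 2) by apply pow2_ge_0; nra.
Qed.

(* With Rocq's [/ 0 = 0] this is [X] itself when [X k k = 0], which is the right convention:
   the row [k] of a semidefinite [X] then vanishes. *)
Definition schur_complement (X : nat -> nat -> R) (k : nat) : nat -> nat -> R :=
  rank1 X (fun i => X i k) (- / X k k).

Lemma psd_schur_complement n X k : psd n X -> (k < n)%nat -> psd n (schur_complement X k).
Proof.
  intros [Hs Hp] Hk; split; [apply sym_rank1; auto|]; intros v.
  unfold schur_complement; rewrite quad_rank1; set (s := dot n (fun i => X i k) v).
  destruct (Req_dec (X k k) 0) as [->|H0].
  { rewrite Rinv_0, Ropp_0, Rmult_0_l, Rplus_0_r; apply Hp. }
  assert (Q := Hp (fun i => 1 * v i + - (s / X k k) * unitv k i)).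
  rewrite quad_lincomb, quad_unitv, (dot_ext_r n v _ (fun i => X i k)) in Q
    by (auto; intros; apply mulmv_unitv; auto).
  rewrite (dot_comm n v) in Q; fold s in Q.
  match type of Q with 0 <= ?q => replace (quad n X v + - / X k k * s ^ 2) with q; [exact Q|] end.
  field; auto.
Qed.

Lemma schur_complement_row n X k j : psd n X -> (k < n)%nat -> (j < n)%nat ->
  schur_complement X k k j = 0.
Proof.
  intros HX Hk Hj; unfold schur_complement, rank1; rewrite (proj1 HX k j) by auto.
  destruct (Req_dec (X k k) 0) as [H0|H0]; [|field; auto].
  rewrite (psd_diag_eq0 n X j k) by auto; ring.
Qed.

Lemma psd_gram_supported n k : (k <= n)%nat -> forall X, psd n X ->
  (forall i j, (k <= i < n)%nat -> (j < n)%nat -> X i j = 0) ->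
  exists y : nat -> nat -> R, forall i j, (i < n)%nat -> (j < n)%nat ->
    X i j = rsum k (fun l => y l i * y l j).
Proof.
  induction k as [|k IH]; intros Hk X HX Hrows.
  - exists (fun _ _ => 0); intros i j Hi Hj; apply Hrows; lia.
  - destruct (IH ltac:(lia) (schur_complement X k)) as [y Hy].
    + apply psd_schur_complement; auto.
    + intros i j Hi Hj; destruct (Nat.eq_dec i k) as [->|].
      * apply (schur_complement_row n); auto.
      * unfold schur_complement, rank1; rewrite !(Hrows i) by lia; ring.
    + exists (fun l i => if Nat.eqb l k then X i k / sqrt (X k k) else y l i).
      intros i j Hi Hj; simpl; rewrite Nat.eqb_refl.
      rewrite (rsum_ext k _ (fun l => y l i * y l j)).
      2:{ intros l Hl; destruct (Nat.eqb_spec l k); [lia|reflexivity]. }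
      rewrite <- Hy by auto; unfold schur_complement, rank1.
      rewrite <- (sqrt_sqrt (X k k)) at 1 by (apply (psd_diag_nonneg n); auto).
      rewrite Rinv_mult; unfold Rdiv; ring.
Qed.

Lemma psd_gram n X : psd n X ->
  exists y : nat -> nat -> R, forall i j, (i < n)%nat -> (j < n)%nat ->
    X i j = rsum n (fun l => y l i * y l j).
Proof. intros HX; apply psd_gram_supported; auto; intros; lia. Qed.

Definition mxtrace (n : nat) (M : nat -> nat -> R) : R := rsum n (fun i => M i i).

Lemma quad_le_mxtrace n M v : psd n M -> quad n M v <= mxtrace n M * sqnorm n v.
Proof.
  intros HM; destruct (psd_gram n M HM) as [y Hy].
  assert (Hquad : quad n M v = rsum n (fun l => dot n (y l) v ^ 2)).
  { rewrite (quad_ext n _ _ v Hy), (rsum_ext n _ _ (fun l _ => eq_sym (quad_outer n (y l) v))).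
    unfold quad; rewrite (rsum_swap n n (fun l i => rsum n _)); apply rsum_ext; intros i _.
    rewrite rsum_swap; apply rsum_ext; intros j _.
    rewrite <- rsum_scal, <- rsum_scal_r; reflexivity. }
  assert (Htrace : mxtrace n M = rsum n (fun l => sqnorm n (y l))).
  { unfold sqnorm; rewrite rsum_swap; apply rsum_ext; auto. }
  rewrite Hquad, Htrace, <- rsum_scal_r; apply rsum_le; intros; apply dot_cauchy_schwarz.
Qed.

(** * Log-convex sequences *)

Section LogConvex.

Variable m : nat -> R.
Hypothesis m_nonneg : forall k, 0 <= m k.
Hypothesis m_logconvex : forall k, m (S k) ^ 2 <= m k * m (S (S k)).

Lemma logconvex_ratio_le i p : m (S i) * m (i + p) <= m i * m (S (i + p)).
Proof.
  induction p as [|p IH]; [rewrite Nat.add_0_r; lra|].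
  rewrite Nat.add_succ_r; set (j := (i + p)%nat) in *.
  assert (Hj := m_logconvex j).
  assert (Hi := m_nonneg i); assert (HSi := m_nonneg (S i)).
  assert (Hm := m_nonneg j); assert (HSm := m_nonneg (S j)); assert (HSSm := m_nonneg (S (S j))).
  destruct (Req_dec (m (S j)) 0) as [->|]; [nra|].
  assert (0 < m j) by nra.
  apply Rmult_le_reg_l with (m j); [auto|].
  apply Rle_trans with (m i * m (S j) ^ 2); nra.
Qed.

Lemma logconvex_supermul i j : m i * m j <= m 0%nat * m (i + j)%nat.
Proof.
  induction j as [|j IH]; [rewrite Nat.add_0_r; lra|].
  assert (Hratio := logconvex_ratio_le j i); rewrite (Nat.add_comm j i) in Hratio.
  rewrite Nat.add_succ_r; assert (Hj := m_logconvex j).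
  assert (H0 := m_nonneg 0); assert (Hi := m_nonneg i); assert (Hm := m_nonneg j).
  assert (HSm := m_nonneg (S j)); assert (HSij := m_nonneg (S (i + j))).
  destruct (Req_dec (m j) 0) as [Z|].
  { rewrite Z in Hj; replace (m (S j)) with 0 by nra; nra. }
  apply Rmult_le_reg_l with (m j); [lra|].
  apply Rle_trans with (m 0%nat * m (i + j)%nat * m (S j)); nra.
Qed.

Lemma logconvex_geometric_le y k : 0 < m 0%nat -> 0 <= y -> y * m 0%nat <= m 1%nat ->
  y ^ k * m 0%nat <= m k.
Proof.
  intros H0 Hy H1; induction k as [|k IH]; [simpl; lra|].
  assert (L := logconvex_supermul 1 k); assert (Hk := m_nonneg k); simpl in *.
  apply Rmult_le_reg_l with (m 0%nat); [auto|].
  apply Rle_trans with (y * m 0%nat * m k).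
  - assert (H := Rmult_le_compat_l (y * m 0%nat) _ _ ltac:(nra) IH); lra.
  - apply Rle_trans with (2 := L); apply Rmult_le_compat_r; auto.
Qed.

End LogConvex.

(** * Powers of a positive semidefinite matrix *)

Definition mulmv_iter (n : nat) (M : nat -> nat -> R) (k : nat) (v : nat -> R) : nat -> R :=
  Nat.iter k (mulmv n M) v.

Definition mxpow (n : nat) (M : nat -> nat -> R) (k i j : nat) : R :=
  mulmv_iter n M k (unitv j) i.

Definition moment (n : nat) (M : nat -> nat -> R) (v : nat -> R) (k : nat) : R :=
  dot n v (mulmv_iter n M k v).

Lemma mulmv_iter_S n M k v : mulmv_iter n M (S k) v = mulmv n M (mulmv_iter n M k v).
Proof. reflexivity. Qed.

Lemma mulmv_iter_S_r n M k v : mulmv_iter n M (S k) v = mulmv_iter n M k (mulmv n M v).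
Proof. apply Nat.iter_succ_r. Qed.

Lemma mulmv_iter_ext n M N k v :
  (forall i j, (i < n)%nat -> (j < n)%nat -> M i j = N i j) ->
  forall i, (i < n)%nat -> mulmv_iter n M k v i = mulmv_iter n N k v i.
Proof.
  intros HM; induction k as [|k IH]; intros i Hi; [reflexivity|].
  apply mulmv_ext; auto.
Qed.

Lemma mulmv_mxpow n M k v i : (i < n)%nat -> mulmv n (mxpow n M k) v i = mulmv_iter n M k v i.
Proof.
  revert i; induction k as [|k IH]; intros i Hi.
  - change (mulmv n (mxpow n M 0) v i = v i).
    rewrite <- (dot_unitv n i v) by auto; apply rsum_ext; intros j _.
    unfold mxpow, mulmv_iter, unitv; simpl; rewrite Nat.eqb_sym; reflexivity.
  - rewrite mulmv_iter_S, (mulmv_ext n M M _ (mulmv n (mxpow n M k) v))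
      by (auto; intros; symmetry; auto).
    unfold mulmv at 2; rewrite (rsum_ext n (fun j => M i j * _)
      (fun j => rsum n (fun l => M i j * mxpow n M k j l * v l))).
    + rewrite rsum_swap; apply rsum_ext; intros l _; rewrite rsum_scal_r; reflexivity.
    + intros; unfold mulmv; rewrite <- rsum_scal; apply rsum_ext; intros; ring.
Qed.

Lemma dot_mulmv_iter_shift n M i j x y : sym_mx n M ->
  dot n (mulmv_iter n M i x) (mulmv_iter n M j y) = dot n x (mulmv_iter n M (i + j) y).
Proof.
  intros HM; revert j; induction i as [|i IH]; intros j; [reflexivity|].
  rewrite mulmv_iter_S, <- dot_mulmv_adj, <- mulmv_iter_S, IH by auto.
  f_equal; f_equal; lia.
Qed.

Lemma dot_mulmv_iter_adj n M k x y : sym_mx n M ->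
  dot n x (mulmv_iter n M k y) = dot n (mulmv_iter n M k x) y.
Proof.
  intros HM; rewrite <- (Nat.add_0_r k) at 1; rewrite <- dot_mulmv_iter_shift by auto; reflexivity.
Qed.

Lemma quad_mxpow n M v k : quad n (mxpow n M k) v = moment n M v k.
Proof. rewrite quad_dot; apply dot_ext_r; intros; apply mulmv_mxpow; auto. Qed.

Lemma moment_mulmv n M v k : sym_mx n M -> moment n M (mulmv n M v) k = moment n M v (S (S k)).
Proof.
  intros HM; unfold moment; rewrite <- mulmv_iter_S_r.
  rewrite <- dot_mulmv_adj, <- mulmv_iter_S by auto; reflexivity.
Qed.

Lemma moment_nonneg n M v k : psd n M -> 0 <= moment n M v k.
Proof.
  intros [Hs Hp]; unfold moment.
  destruct (Nat.Even_or_Odd k) as [[j ->]|[j ->]].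
  - replace (2 * j)%nat with (j + j)%nat by lia.
    rewrite <- dot_mulmv_iter_shift by auto; apply sqnorm_nonneg.
  - replace (2 * j + 1)%nat with (j + S j)%nat by lia.
    rewrite <- dot_mulmv_iter_shift, mulmv_iter_S, <- quad_dot by auto; apply Hp.
Qed.

Lemma psd_mxpow n M k : psd n M -> psd n (mxpow n M k).
Proof.
  intros HM; split.
  - intros i j Hi Hj; unfold mxpow.
    rewrite <- (dot_unitv n i), dot_mulmv_iter_adj, dot_comm, dot_unitv by (auto; apply HM).
    reflexivity.
  - intros v; rewrite quad_mxpow; apply moment_nonneg; auto.
Qed.

Lemma moment_logconvex n M v k : psd n M ->
  moment n M v (S k) ^ 2 <= moment n M v k * moment n M v (S (S k)).
Proof.
  intros HM; assert (Hs := proj1 HM).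
  assert (C := psd_cauchy_schwarz n _ v (mulmv n M v) (psd_mxpow n M k HM)).
  rewrite !quad_mxpow, moment_mulmv in C by auto.
  rewrite (dot_ext_r n v _ _ (fun i Hi => mulmv_mxpow n M k (mulmv n M v) i Hi)) in C.
  rewrite <- mulmv_iter_S_r in C; exact C.
Qed.

Lemma moment_supermul n M v i j : psd n M ->
  moment n M v i * moment n M v j <= sqnorm n v * moment n M v (i + j).
Proof.
  intros HM; apply (logconvex_supermul (moment n M v)).
  - intros; apply moment_nonneg; auto.
  - intros; apply moment_logconvex; auto.
Qed.

Lemma moment_lower n M v y k : psd n M -> 0 < sqnorm n v -> 0 <= y ->
  y * sqnorm n v <= quad n M v -> y ^ k * sqnorm n v <= moment n M v k.
Proof.
  intros HM Hv Hy Hquad; apply (logconvex_geometric_le (moment n M v)); auto.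
  - intros; apply moment_nonneg; auto.
  - intros; apply moment_logconvex; auto.
  - rewrite quad_dot in Hquad; exact Hquad.
Qed.

Lemma moment_S_le n M v b k : psd n M -> 0 <= b ->
  (forall w, quad n M w <= b * sqnorm n w) -> moment n M v (S k) <= b * moment n M v k.
Proof.
  intros HM Hb Hquad; revert v.
  assert (H : forall v, moment n M v (S k) <= b * moment n M v k /\
                        moment n M v (S (S k)) <= b * moment n M v (S k)); [|apply H].
  induction k as [|k IH]; intros v.
  - split.
    + specialize (Hquad v); rewrite quad_dot in Hquad; exact Hquad.
    + rewrite <- moment_mulmv by apply HM.
      assert (Q := psd_sqnorm_mulmv_le n M b v HM Hb Hquad); rewrite quad_dot in Q; exact Q.
  - split; [apply IH|].
    rewrite <- !(moment_mulmv n M v) by apply HM; apply IH.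
Qed.

(** * Truncated trace exponential *)

Definition exp_partial (K : nat) (y : R) : R := rsum K (fun k => y ^ k / INR (fact k)).

Definition trace_exp (n K : nat) (M : nat -> nat -> R) : R :=
  rsum K (fun k => mxtrace n (mxpow n M k) / INR (fact k)).

Lemma inv_fact_nonneg k : 0 <= / INR (fact k).
Proof. left; apply Rinv_0_lt_compat, INR_fact_lt_0. Qed.

Lemma INR_S_div_fact_S k x : INR (S k) * x / INR (fact (S k)) = x / INR (fact k).
Proof.
  rewrite fact_simpl, mult_INR; field; split; [apply INR_fact_neq_0|apply not_0_INR; lia].
Qed.

Lemma rsum_sum_f_R0 f K : rsum (S K) f = sum_f_R0 f K.
Proof. induction K as [|K IH]; [simpl; ring|]; simpl in *; rewrite IH; reflexivity. Qed.

Lemma exp_partial_le y K : 0 <= y -> exp_partial (S K) y <= exp y.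
Proof. intros Hy; unfold exp_partial; rewrite rsum_sum_f_R0; apply exp_ge_taylor; auto. Qed.

Lemma exp_partial_lim y : is_lim_seq (fun K => exp_partial (S K) y) (exp y).
Proof.
  assert (E := is_exp_Reals y); apply is_pseries_R in E.
  apply (is_lim_seq_ext (sum_n (fun k => / INR (fact k) * y ^ k))); [|exact E].
  intros K; unfold exp_partial; rewrite sum_n_Reals, rsum_sum_f_R0.
  apply sum_eq; intros; apply Rmult_comm.
Qed.

Lemma scal_exp_le_of_partial q y b :
  (forall K, q * exp_partial (S K) y <= b) -> q * exp y <= b.
Proof.
  intros H.
  apply (is_lim_seq_le (fun K => q * exp_partial (S K) y) (fun _ => b) (q * exp y) b H).
  - apply (is_lim_seq_scal_l _ q (exp y)), exp_partial_lim.
  - apply is_lim_seq_const.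
Qed.

Lemma mxtrace_mxpow n M k :
  mxtrace n (mxpow n M k) = rsum n (fun l => moment n M (unitv l) k).
Proof. apply rsum_ext; intros; unfold moment; rewrite dot_unitv by auto; reflexivity. Qed.

Lemma trace_exp_ext n K M N :
  (forall i j, (i < n)%nat -> (j < n)%nat -> M i j = N i j) ->
  trace_exp n K M = trace_exp n K N.
Proof.
  intros H; apply rsum_ext; intros k _; f_equal; apply rsum_ext; intros l Hl.
  apply mulmv_iter_ext; auto.
Qed.

Lemma trace_exp_nonneg n K M : psd n M -> 0 <= trace_exp n K M.
Proof.
  intros HM; apply rsum_nonneg; intros; apply Rmult_le_pos; [|apply inv_fact_nonneg].
  rewrite mxtrace_mxpow; apply rsum_nonneg; intros; apply moment_nonneg; auto.
Qed.

Lemma trace_exp_lower n K M v y : psd n M -> 0 < sqnorm n v -> 0 <= y ->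
  y * sqnorm n v <= quad n M v -> exp_partial K y <= trace_exp n K M.
Proof.
  intros HM Hv Hy Hquad; apply rsum_le; intros k _.
  apply Rmult_le_compat_r; [apply inv_fact_nonneg|].
  apply Rmult_le_reg_r with (sqnorm n v); [auto|].
  apply Rle_trans with (moment n M v k); [apply moment_lower; auto|].
  rewrite <- quad_mxpow; apply quad_le_mxtrace, psd_mxpow; auto.
Qed.

Lemma mxtrace_mxpow_le n M b k : psd n M -> 0 <= b ->
  (forall w, quad n M w <= b * sqnorm n w) -> mxtrace n (mxpow n M k) <= INR n * b ^ k.
Proof.
  intros HM Hb Hquad; rewrite mxtrace_mxpow, <- rsum_const; apply rsum_le; intros l Hl.
  induction k as [|k IH].
  - change (sqnorm n (unitv l) <= 1); rewrite sqnorm_unitv by auto; lra.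
  - apply Rle_trans with (b * moment n M (unitv l) k); [apply moment_S_le; auto|].
    simpl; apply Rmult_le_compat_l; auto.
Qed.

Lemma trace_exp_upper n K M b : psd n M -> 0 <= b ->
  (forall w, quad n M w <= b * sqnorm n w) -> trace_exp n (S K) M <= INR n * exp b.
Proof.
  intros HM Hb Hquad; apply Rle_trans with (INR n * exp_partial (S K) b).
  - unfold exp_partial; rewrite <- rsum_scal; apply rsum_le; intros k _.
    unfold Rdiv; rewrite <- Rmult_assoc; apply Rmult_le_compat_r; [apply inv_fact_nonneg|].
    apply mxtrace_mxpow_le; auto.
  - apply Rmult_le_compat_l; [apply pos_INR|apply exp_partial_le; auto].
Qed.

(** * Concavity in the exponential *)

Lemma mean_value (f df : R -> R) x y :
  (forall c, Rmin x y <= c <= Rmax x y -> is_derive f c (df c)) ->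
  exists c, Rmin x y <= c <= Rmax x y /\ f y - f x = df c * (y - x).
Proof.
  intros D; apply MVT_gen; [intros c Hc; apply D; lra|].
  intros c Hc; apply continuity_pt_filterlim, (ex_derive_continuous f).
  exists (df c); apply D; auto.
Qed.

Lemma exp_le x y : x <= y -> exp x <= exp y.
Proof. intros [H|<-]; [left; apply exp_increasing; auto|right; reflexivity]. Qed.

Section ConcaveInExp.

(* [f'' <= f'] says that [exp (- c) * f' c], the derivative of [f] with respect to [exp c],
   is nonincreasing. *)
Variables (f f' : R -> R) (a : R).
Hypothesis f_derive : forall c, a <= c -> is_derive f c (f' c).
Hypothesis f'_derive_le : forall c, a <= c -> ex_derive f' c /\ Derive f' c <= f' c.

Lemma deriv_wrt_exp_nonincreasing x y : a <= x -> x <= y -> exp (- y) * f' y <= exp (- x) * f' x.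
Proof.
  intros Hx Hxy.
  destruct (mean_value (fun c => exp (- c) * f' c)
              (fun c => exp (- c) * (Derive f' c - f' c)) x y) as [c [Hc E]];
    rewrite Rmin_left, Rmax_right in * by auto.
  - intros c Hc; auto_derive; [apply f'_derive_le; lra|].
    change (Derive (fun t => f' t) c) with (Derive f' c); ring.
  - destruct (f'_derive_le c ltac:(lra)) as [_ Hle].
    assert (0 < exp (- c)) by apply exp_pos.
    assert (exp (- c) * (Derive f' c - f' c) <= 0) by nra; nra.
Qed.

Lemma exp_tangent_le s c : a <= s -> a <= c ->
  f c <= f s + exp (- s) * f' s * (exp c - exp s).
Proof.
  intros Hs Hc; set (g := exp (- s) * f' s).
  destruct (mean_value (fun z => f z - g * exp z) (fun z => exp z * (exp (- z) * f' z - g)) s c)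
    as [z [Hz E]].
  - intros z Hz; assert (a <= z) by (assert (X := Rmin_glb s c a); lra).
    auto_derive; [exists (f' z); auto|].
    change (Derive (fun t => f t) z) with (Derive f z).
    rewrite (is_derive_unique f z (f' z)), exp_Ropp by auto.
    field; apply Rgt_not_eq, exp_pos.
  - assert (P := exp_pos z).
    assert (exp z * (exp (- z) * f' z - g) * (c - s) <= 0); [|lra].
    destruct (Rle_dec s c).
    + rewrite Rmin_left, Rmax_right in Hz by auto.
      assert (exp (- z) * f' z <= g) by (apply deriv_wrt_exp_nonincreasing; lra).
      assert (exp z * (exp (- z) * f' z - g) <= 0) by nra; nra.
    + rewrite Rmin_right, Rmax_left in Hz by lra.
      assert (g <= exp (- z) * f' z) by (apply deriv_wrt_exp_nonincreasing; lra).
      assert (0 <= exp z * (exp (- z) * f' z - g)) by nra; nra.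
Qed.

Lemma concave_in_exp p x y : 0 <= p <= 1 -> a <= x -> a <= y ->
  (1 - p) * f x + p * f y <= f (ln ((1 - p) * exp x + p * exp y)).
Proof.
  intros Hp Hx Hy; set (s := ln _).
  assert (Px := exp_le a x Hx); assert (Py := exp_le a y Hy); assert (Pa := exp_pos a).
  assert (Ha : exp a <= (1 - p) * exp x + p * exp y) by nra.
  assert (Es : exp s = (1 - p) * exp x + p * exp y) by (apply exp_ln; lra).
  assert (Hs : a <= s) by (apply Rnot_lt_le; intros L; apply exp_increasing in L; lra).
  assert (Tx := exp_tangent_le s x Hs Hx); assert (Ty := exp_tangent_le s y Hs Hy).
  apply Rmult_le_compat_l with (r := 1 - p) in Tx; [|lra].
  apply Rmult_le_compat_l with (r := p) in Ty; [|lra].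
  rewrite Es in Tx, Ty; lra.
Qed.

End ConcaveInExp.

(** * The trace exponential along a rank-one direction *)

Lemma is_derive_rsum n (F : nat -> R -> R) (F' : nat -> R) x :
  (forall i, (i < n)%nat -> is_derive (F i) x (F' i)) ->
  is_derive (fun y => rsum n (fun i => F i y)) x (rsum n F').
Proof.
  induction n as [|n IH]; intros H; simpl; [apply (is_derive_const 0)|].
  apply (is_derive_plus (fun y => rsum n (fun i => F i y)) (F n)); auto.
Qed.

Lemma dot_mulmv_iter_rank1_S n M u c x y k : sym_mx n M ->
  dot n x (mulmv_iter n (rank1 M u c) (S k) y) =
  dot n (mulmv n M x) (mulmv_iter n (rank1 M u c) k y) +
  c * (dot n x u * dot n u (mulmv_iter n (rank1 M u c) k y)).
Proof.
  intros HM; rewrite mulmv_iter_S, (dot_ext_r n x _ _ (fun i _ => mulmv_rank1 n M u c _ i)).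
  rewrite dot_linear_r, dot_mulmv_adj by auto; ring.
Qed.

Lemma is_derive_div_const (F : R -> R) (c l w : R) :
  is_derive F c l -> is_derive (fun c => F c / w) c (l / w).
Proof. apply (is_derive_scal_l F c l (/ w)). Qed.

Lemma is_derive_plus_id_mult (F G : R -> R) (c w F' G' : R) :
  is_derive F c F' -> is_derive G c G' ->
  is_derive (fun c => F c + c * (w * G c)) c (w * G c + (F' + c * w * G')).
Proof.
  intros DF DG; auto_derive; [split; [exists F'|split; [exists G'|]]; auto|].
  change (Derive (fun t => F t) c) with (Derive F c).
  change (Derive (fun t => G t) c) with (Derive G c).
  rewrite (is_derive_unique F c F'), (is_derive_unique G c G') by auto; ring.
Qed.

(* Leibniz' rule: [d/dc N^k = sum_(i < k) N^i u u^T N^(k-1-i)] for [N = M + c u u^T]. *)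
Lemma is_derive_dot_mulmv_iter n M u y (c : R) k : sym_mx n M -> forall x,
  is_derive (fun c => dot n x (mulmv_iter n (rank1 M u c) k y)) c
    (rsum k (fun i => dot n x (mulmv_iter n (rank1 M u c) i u) *
                      dot n u (mulmv_iter n (rank1 M u c) (k - S i) y))).
Proof.
  intros HM; induction k as [|k IH]; intros x; [apply (is_derive_const (dot n x y))|].
  apply is_derive_ext with
    (fun c => dot n (mulmv n M x) (mulmv_iter n (rank1 M u c) k y) +
              c * (dot n x u * dot n u (mulmv_iter n (rank1 M u c) k y))).
  { intros; symmetry; apply dot_mulmv_iter_rank1_S; auto. }
  rewrite rsum_S_l; change (mulmv_iter n (rank1 M u c) 0 u) with u.
  replace (S k - 1)%nat with k by lia.
  rewrite (rsum_ext k (fun i => dot n x (mulmv_iter n (rank1 M u c) (S i) u) * _)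
    (fun i => dot n (mulmv n M x) (mulmv_iter n (rank1 M u c) i u) *
              dot n u (mulmv_iter n (rank1 M u c) (k - S i) y) +
              c * dot n x u * (dot n u (mulmv_iter n (rank1 M u c) i u) *
              dot n u (mulmv_iter n (rank1 M u c) (k - S i) y)))).
  - rewrite rsum_plus, rsum_scal; apply is_derive_plus_id_mult; apply IH.
  - intros i Hi; rewrite dot_mulmv_iter_rank1_S by auto; simpl Nat.sub; ring.
Qed.

Lemma is_derive_mxtrace_mxpow n M u (c : R) k : sym_mx n M ->
  is_derive (fun c => mxtrace n (mxpow n (rank1 M u c) k)) c
    (INR k * moment n (rank1 M u c) u (pred k)).
Proof.
  intros HM; assert (HN := sym_rank1 n M u c HM).
  apply is_derive_ext with (fun c => rsum n (fun l => moment n (rank1 M u c) (unitv l) k)).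
  { intros; symmetry; apply mxtrace_mxpow. }
  set (N := rank1 M u c) in *.
  replace (INR k * moment n N u (pred k)) with
    (rsum n (fun l => rsum k (fun i => dot n (unitv l) (mulmv_iter n N i u) *
                                       dot n u (mulmv_iter n N (k - S i) (unitv l))))).
  - apply (is_derive_rsum n (fun l c => moment n (rank1 M u c) (unitv l) k)).
    intros; apply is_derive_dot_mulmv_iter; auto.
  - rewrite rsum_swap, <- rsum_const; apply rsum_ext; intros i Hi.
    transitivity (dot n (mulmv_iter n N i u) (mulmv_iter n N (k - S i) u)).
    + apply rsum_ext; intros l Hl; rewrite (dot_mulmv_iter_adj n N _ u) by auto.
      rewrite (dot_comm n _ (unitv l)), !dot_unitv by auto; reflexivity.
    + rewrite dot_mulmv_iter_shift by auto; unfold moment; f_equal; f_equal; lia.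
Qed.

Definition moment_exp (n K : nat) (M : nat -> nat -> R) (u : nat -> R) : R :=
  rsum K (fun k => moment n M u k / INR (fact k)).

Lemma is_derive_trace_exp n K M u (c : R) : sym_mx n M ->
  is_derive (fun c => trace_exp n (S K) (rank1 M u c)) c (moment_exp n K (rank1 M u c) u).
Proof.
  intros HM.
  replace (moment_exp n K (rank1 M u c) u) with
    (rsum (S K) (fun k => INR k * moment n (rank1 M u c) u (pred k) / INR (fact k))).
  - apply (is_derive_rsum (S K) (fun k c => mxtrace n (mxpow n (rank1 M u c) k) / INR (fact k))).
    intros k _; apply (is_derive_div_const (fun c => mxtrace n (mxpow n (rank1 M u c) k))).
    apply is_derive_mxtrace_mxpow; auto.
  - rewrite rsum_S_l; unfold Rdiv at 1; simpl INR at 1; rewrite !Rmult_0_l, Rplus_0_l.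
    apply rsum_ext; intros k _; apply INR_S_div_fact_S.
Qed.

Definition moment_exp_deriv (n K : nat) (M : nat -> nat -> R) (u : nat -> R) : R :=
  rsum K (fun k => rsum k (fun i => moment n M u i * moment n M u (k - S i)) / INR (fact k)).

Lemma is_derive_moment_exp n K M u (c : R) : sym_mx n M ->
  is_derive (fun c => moment_exp n K (rank1 M u c) u) c (moment_exp_deriv n K (rank1 M u c) u).
Proof.
  intros HM; apply (is_derive_rsum K (fun k c => moment n (rank1 M u c) u k / INR (fact k))).
  intros k _; apply (is_derive_div_const (fun c => moment n (rank1 M u c) u k)).
  apply is_derive_dot_mulmv_iter; auto.
Qed.

Lemma moment_exp_deriv_le n K M u : psd n M -> sqnorm n u = 1 ->
  moment_exp_deriv n K M u <= moment_exp n K M u.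
Proof.
  intros HM Hu; unfold moment_exp_deriv.
  destruct K as [|K]; [apply Rle_refl|].
  rewrite rsum_S_l; simpl rsum at 1; unfold Rdiv at 1; rewrite Rmult_0_l, Rplus_0_l.
  apply Rle_trans with (moment_exp n K M u).
  - apply rsum_le; intros k _; rewrite <- (INR_S_div_fact_S k (moment n M u k)).
    apply Rmult_le_compat_r; [apply inv_fact_nonneg|].
    rewrite <- rsum_const; apply rsum_le; intros i Hi.
    assert (L := moment_supermul n M u i (S k - S i) HM).
    rewrite Hu, Rmult_1_l in L; replace (i + (S k - S i))%nat with k in L by lia; exact L.
  - unfold moment_exp; simpl rsum at 2.
    assert (P := Rmult_le_pos _ _ (moment_nonneg n M u K HM) (inv_fact_nonneg K)).
    unfold Rdiv in *; lra.
Qed.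

Lemma trace_exp_rank1_concave n K M u p x y : psd n M -> sqnorm n u = 1 ->
  0 <= p <= 1 -> 0 <= x -> 0 <= y ->
  (1 - p) * trace_exp n (S K) (rank1 M u x) + p * trace_exp n (S K) (rank1 M u y) <=
  trace_exp n (S K) (rank1 M u (ln ((1 - p) * exp x + p * exp y))).
Proof.
  intros HM Hu.
  apply (concave_in_exp (fun c => trace_exp n (S K) (rank1 M u c))
          (fun c => moment_exp n K (rank1 M u c) u)).
  - intros; apply is_derive_trace_exp, HM.
  - intros c Hc; assert (D := is_derive_moment_exp n K M u c (proj1 HM)); split.
    + exists (moment_exp_deriv n K (rank1 M u c) u); exact D.
    + apply Rle_trans with (moment_exp_deriv n K (rank1 M u c) u);
        [right; apply is_derive_unique, D|].
      apply moment_exp_deriv_le; auto; apply psd_rank1; auto.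
Qed.

(** * Independent Bernoulli noise *)

Definition expectation (p : R) (m : nat) (f : list bool -> R) : R :=
  lsum (blists m) (fun zs => weight p zs * f zs).

Definition indicator (P : list bool -> Prop) (zs : list bool) : R :=
  if excluded_middle_informative (P zs) then 1 else 0.

Lemma prob_expectation n a p P : prob n a p P = expectation p (length (edges n a)) (indicator P).
Proof.
  unfold prob, expectation; change (fold_right _ 0 ?l) with
    (lsum l (fun zs => if excluded_middle_informative (P zs) then weight p zs else 0)).
  apply lsum_ext; intros zs _; unfold indicator.
  destruct (excluded_middle_informative (P zs)); ring.
Qed.

Lemma expectation_S p m f :
  expectation p (S m) f =
  (1 - p) * expectation p m (fun zs => f (false :: zs)) +
  p * expectation p m (fun zs => f (true :: zs)).
Proof.
  unfold expectation; simpl blists; rewrite lsum_app, !lsum_map, Rplus_comm, <- !lsum_scal.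
  f_equal; apply lsum_ext; intros; simpl; ring.
Qed.

Lemma expectation_ext p m f g : (forall zs, f zs = g zs) -> expectation p m f = expectation p m g.
Proof. intros H; apply lsum_ext; intros; rewrite H; reflexivity. Qed.

Lemma expectation_le p m f g : 0 <= p <= 1 ->
  (forall zs, length zs = m -> f zs <= g zs) -> expectation p m f <= expectation p m g.
Proof.
  intros Hp; revert f g; induction m as [|m IH]; intros f g H.
  - specialize (H [] eq_refl); unfold expectation; simpl; lra.
  - rewrite !expectation_S; apply Rplus_le_compat; apply Rmult_le_compat_l; try lra;
      apply IH; intros; apply H; simpl; auto.
Qed.

Lemma expectation_affine p m a b f :
  expectation p m (fun zs => a + b * f zs) = a + b * expectation p m f.
Proof.
  revert f; induction m as [|m IH]; intros f.
  - unfold expectation; simpl; ring.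
  - rewrite !expectation_S, (IH (fun zs => f (false :: zs))), (IH (fun zs => f (true :: zs))); ring.
Qed.

Lemma expectation_markov p m P G y : 0 <= p <= 1 ->
  (forall zs, length zs = m -> 0 <= G zs) ->
  (forall zs, length zs = m -> ~ P zs -> y <= G zs) ->
  (1 - expectation p m (indicator P)) * y <= expectation p m G.
Proof.
  intros Hp HG Hy.
  replace ((1 - expectation p m (indicator P)) * y)
    with (expectation p m (fun zs => y + - y * indicator P zs))
    by (rewrite expectation_affine; ring).
  apply expectation_le; auto; intros zs Hz; unfold indicator.
  specialize (HG zs Hz); specialize (Hy zs Hz).
  destruct (excluded_middle_informative (P zs)); [lra|].
  assert (y <= G zs) by auto; lra.
Qed.

Definition bernoulli_cgf (p k : R) : R := ln (1 - p + p * exp k).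

Lemma mean_le_bernoulli_cgf p k : 0 <= p <= 1 -> 0 <= k -> k * p <= bernoulli_cgf p k.
Proof.
  intros Hp Hk.
  assert (C : (1 - p) * 0 + p * k <= ln ((1 - p) * exp 0 + p * exp k)).
  { apply (concave_in_exp (fun c => c) (fun _ => 1) 0); try lra.
    - intros; apply (is_derive_id (K := R_AbsRing)).
    - intros; rewrite Derive_const; split; [apply ex_derive_const|lra]. }
  rewrite exp_0, Rmult_1_r in C; unfold bernoulli_cgf; lra.
Qed.

(** * Random sums of rank-one projections *)

Definition add_rank1s (M : nat -> nat -> R) (l : list ((nat -> R) * R)) : nat -> nat -> R :=
  fold_right (fun q N => rank1 N (fst q) (snd q)) M l.

Lemma quad_add_rank1s n M l v :
  quad n (add_rank1s M l) v = quad n M v + lsum l (fun q => snd q * dot n (fst q) v ^ 2).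
Proof. induction l as [|q l IH]; simpl; [ring|]; rewrite quad_rank1, IH; simpl; ring. Qed.

Lemma sym_add_rank1s n M l : sym_mx n M -> sym_mx n (add_rank1s M l).
Proof. intros HM; induction l as [|q l IH]; simpl; [auto|apply sym_rank1; auto]. Qed.

Lemma psd_add_rank1s n M l : psd n M -> Forall (fun q => 0 <= snd q) l -> psd n (add_rank1s M l).
Proof. intros HM H; induction H as [|q l Hq Hl IH]; simpl; [auto|apply psd_rank1; auto]. Qed.

Lemma add_rank1s_rank1 M u c l i j :
  add_rank1s (rank1 M u c) l i j = rank1 (add_rank1s M l) u c i j.
Proof. induction l as [|q l IH]; simpl; [reflexivity|]; unfold rank1 in *; rewrite IH; ring. Qed.

Definition const_terms (c : R) (us : list (nat -> R)) : list ((nat -> R) * R) :=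
  map (fun u => (u, c)) us.

Definition noise_terms (k : R) (us : list (nat -> R)) (zs : list bool) : list ((nat -> R) * R) :=
  map (fun q => (fst q, k * INR (Nat.b2n (snd q)))) (combine us zs).

Lemma const_terms_nonneg c us : 0 <= c -> Forall (fun q => 0 <= snd q) (const_terms c us).
Proof.
  intros Hc; apply Forall_forall; intros q Hq; apply in_map_iff in Hq as [u [<- _]]; auto.
Qed.

Lemma noise_terms_nonneg k us zs : 0 <= k -> Forall (fun q => 0 <= snd q) (noise_terms k us zs).
Proof.
  intros Hk; apply Forall_forall; intros q Hq; apply in_map_iff in Hq as [[u z] [<- _]].
  apply Rmult_le_pos; [auto|apply pos_INR].
Qed.

(* Replaces the Golden-Thompson/Lieb step of the matrix Laplace transform method. *)
Lemma expected_trace_exp_le n K p k us : Forall (fun u => sqnorm n u = 1) us ->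
  0 <= p <= 1 -> 0 <= k -> forall M, psd n M ->
  expectation p (length us) (fun zs => trace_exp n (S K) (add_rank1s M (noise_terms k us zs))) <=
  trace_exp n (S K) (add_rank1s M (const_terms (bernoulli_cgf p k) us)).
Proof.
  intros Hus Hp Hk; induction Hus as [|u us Hu Hus IH]; intros M HM.
  - unfold expectation, noise_terms, const_terms; simpl; lra.
  - set (N := add_rank1s M (const_terms (bernoulli_cgf p k) us)).
    assert (HN : psd n N).
    { apply psd_add_rank1s, const_terms_nonneg; auto.
      assert (L := mean_le_bernoulli_cgf p k Hp Hk); nra. }
    assert (given_head : forall z, expectation p (length us) (fun zs =>
        trace_exp n (S K) (add_rank1s M (noise_terms k (u :: us) (z :: zs)))) <=
      trace_exp n (S K) (rank1 N u (k * INR (Nat.b2n z)))).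
    { intros z; set (c := k * INR (Nat.b2n z)).
      rewrite (expectation_ext _ _ _ (fun zs =>
        trace_exp n (S K) (add_rank1s (rank1 M u c) (noise_terms k us zs))))
        by (intros; apply trace_exp_ext; intros; symmetry; apply add_rank1s_rank1).
      rewrite <- (trace_exp_ext n (S K) (add_rank1s (rank1 M u c) (const_terms _ us)))
        by (intros; apply add_rank1s_rank1).
      apply IH, psd_rank1; auto; apply Rmult_le_pos; [auto|apply pos_INR]. }
    simpl length; rewrite expectation_S.
    assert (Hfalse := given_head false); assert (Htrue := given_head true).
    simpl INR in Hfalse, Htrue.
    rewrite Rmult_0_r in Hfalse; rewrite Rmult_1_r in Htrue.
    assert (C := trace_exp_rank1_concave n K N u p 0 k HN Hu Hp (Rle_refl 0) Hk).
    rewrite exp_0, Rmult_1_r in C.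
    apply Rle_trans with (2 := C); apply Rplus_le_compat; apply Rmult_le_compat_l; lra || auto.
Qed.

Section MatrixConcentration.

Variables (n : nat) (us : list (nat -> R)) (p D : R).
Hypothesis us_unit : Forall (fun u => sqnorm n u = 1) us.
Hypothesis p_range : 0 < p < 1.
Hypothesis D_nonneg : 0 <= D.
Hypothesis us_frame : forall v, lsum us (fun u => dot n u v ^ 2) <= D * sqnorm n v.

(* Subtracting the mean [a sum u u^T] of the noise would lose semidefiniteness; the shift by
   [a D] restores it. *)
Definition shifted_mean (a : R) : nat -> nat -> R :=
  add_rank1s (scalar_mx (a * D)) (const_terms (- a) us).

Definition deviation (zs : list bool) (v : nat -> R) : R :=
  lsum (combine us zs) (fun q => (INR (Nat.b2n (snd q)) - p) * dot n (fst q) v ^ 2).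

Lemma quad_shifted_mean a v :
  quad n (shifted_mean a) v = a * D * sqnorm n v - a * lsum us (fun u => dot n u v ^ 2).
Proof.
  unfold shifted_mean, const_terms; rewrite quad_add_rank1s, quad_scalar_mx, lsum_map.
  simpl snd; rewrite lsum_scal; simpl; ring.
Qed.

Lemma psd_shifted_mean a : 0 <= a -> psd n (shifted_mean a).
Proof.
  intros Ha; split; [apply sym_add_rank1s, sym_scalar_mx|].
  intros v; rewrite quad_shifted_mean; specialize (us_frame v); nra.
Qed.

Lemma quad_shifted_noise k zs v : length zs = length us ->
  quad n (add_rank1s (shifted_mean (k * p)) (noise_terms k us zs)) v =
  k * p * D * sqnorm n v + k * deviation zs v.
Proof.
  intros Hz; rewrite quad_add_rank1s, quad_shifted_mean; unfold noise_terms, deviation.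
  rewrite lsum_map, <- (lsum_combine_fst us zs) by auto; simpl fst; simpl snd.
  unfold Rminus; rewrite Rplus_assoc; f_equal.
  rewrite Ropp_mult_distr_l, <- !lsum_scal, <- lsum_plus; apply lsum_ext; intros; ring.
Qed.

Lemma trace_exp_shifted_cgf_le K k : 0 <= k ->
  trace_exp n (S K) (add_rank1s (shifted_mean (k * p)) (const_terms (bernoulli_cgf p k) us)) <=
  INR n * exp (bernoulli_cgf p k * D).
Proof.
  intros Hk; assert (L := mean_le_bernoulli_cgf p k ltac:(lra) Hk).
  assert (0 <= k * p) by nra.
  apply trace_exp_upper; [|nra|].
  - apply psd_add_rank1s; [apply psd_shifted_mean|apply const_terms_nonneg]; lra.
  - intros w; rewrite quad_add_rank1s, quad_shifted_mean; unfold const_terms.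
    rewrite lsum_map; simpl snd; simpl fst; rewrite lsum_scal.
    specialize (us_frame w); nra.
Qed.

Lemma rank1_chernoff P k t : 0 <= k -> 0 <= t ->
  (forall zs, length zs = length us -> ~ P zs ->
     exists v, 0 < sqnorm n v /\ t * sqnorm n v <= deviation zs v) ->
  1 - expectation p (length us) (indicator P) <=
  INR n * exp ((bernoulli_cgf p k - k * p) * D - k * t).
Proof.
  intros Hk Ht HP; set (q := 1 - _).
  assert (Hkp : 0 <= k * p) by nra.
  assert (psd_noise : forall zs, psd n (add_rank1s (shifted_mean (k * p)) (noise_terms k us zs)))
    by (intros; apply psd_add_rank1s; [apply psd_shifted_mean|apply noise_terms_nonneg]; auto).
  assert (Hexp : q * exp (k * p * D + k * t) <= INR n * exp (bernoulli_cgf p k * D)).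
  { apply scal_exp_le_of_partial; intros K.
    apply Rle_trans with (2 := trace_exp_shifted_cgf_le K k Hk).
    apply Rle_trans with
      (2 := expected_trace_exp_le n K p k us us_unit ltac:(lra) Hk _ (psd_shifted_mean _ Hkp)).
    apply expectation_markov; [lra|intros; apply trace_exp_nonneg; auto|].
    intros zs Hz Hn; destruct (HP zs Hz Hn) as [v [Hv Hdev]].
    apply trace_exp_lower with v; auto; [nra|].
    rewrite quad_shifted_noise by auto; nra. }
  apply Rmult_le_reg_r with (exp (k * p * D + k * t)); [apply exp_pos|].
  rewrite (Rmult_assoc (INR n)), <- exp_plus; apply Rle_trans with (1 := Hexp).
  right; f_equal; f_equal; ring.
Qed.

End MatrixConcentration.

(** * Bernstein's inequality *)

Lemma exp_pade_le y : (1 - y / 3) * exp y <= 1 + 2 / 3 * y + y ^ 2 / 6.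
Proof.
  destruct (mean_value (fun x => 1 + 2 / 3 * x + x ^ 2 / 6 - (1 - x / 3) * exp x)
    (fun x => 2 / 3 + x / 3 - (2 / 3 - x / 3) * exp x) 0 y) as [c [Hc Ec]].
  { intros; auto_derive; [exact I|field]. }
  destruct (mean_value (fun x => 2 / 3 + x / 3 - (2 / 3 - x / 3) * exp x)
    (fun x => 1 / 3 * (1 - (1 - x) * exp x)) 0 c) as [z [_ Ez]].
  { intros; auto_derive; [exact I|field]. }
  assert (second_deriv_nonneg : 0 <= 1 - (1 - z) * exp z).
  { assert (L := exp_ineq1_le (- z)); assert (X := exp_pos z); rewrite exp_Ropp in L.
    apply Rmult_le_compat_r with (r := exp z) in L; [|lra].
    rewrite Rinv_l in L by lra; lra. }
  assert (0 <= c * y).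
  { destruct (Rle_dec 0 y); [rewrite Rmin_left, Rmax_right in Hc by lra|
      rewrite Rmin_right, Rmax_left in Hc by lra]; nra. }
  assert (0 <= (1 - (1 - z) * exp z) * (c * y)) by (apply Rmult_le_pos; auto).
  rewrite exp_0 in Ec, Ez.
  replace (2 / 3 + c / 3 - (2 / 3 - c / 3) * exp c)
    with (1 / 3 * (1 - (1 - z) * exp z) * c) in Ec by lra.
  lra.
Qed.

Lemma exp_bernstein y r : y <= r -> r < 3 -> exp y <= 1 + y + y ^ 2 / 2 / (1 - r / 3).
Proof.
  intros Hy Hr; assert (P := exp_pade_le y).
  apply Rle_trans with (1 + y + y ^ 2 / 2 / (1 - y / 3)).
  - apply Rmult_le_reg_l with (1 - y / 3); [lra|].
    replace ((1 - y / 3) * (1 + y + y ^ 2 / 2 / (1 - y / 3)))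
      with (1 + 2 / 3 * y + y ^ 2 / 6) by (field; lra).
    exact P.
  - apply Rplus_le_compat_l, Rmult_le_compat_l; [assert (0 <= y ^ 2) by apply pow2_ge_0; lra|].
    apply Rinv_le_contravar; lra.
Qed.

Lemma bernoulli_cgf_bernstein p k : 0 < p < 1 -> 0 <= k -> k * (1 - p) < 3 ->
  bernoulli_cgf p k - k * p <= p * (1 - p) * k ^ 2 / 2 / (1 - k * (1 - p) / 3).
Proof.
  intros Hp Hk Hr; set (r := k * (1 - p)); set (V := _ / (1 - r / 3)).
  assert (Hone := exp_bernstein r r ltac:(lra) Hr).
  assert (Hzero := exp_bernstein (- (k * p)) r ltac:(unfold r; nra) Hr).
  assert (centered_mgf_le : (1 - p + p * exp k) * exp (- (k * p)) <= exp V).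
  { apply Rle_trans with (1 + V); [|apply exp_ineq1_le].
    replace ((1 - p + p * exp k) * exp (- (k * p)))
      with ((1 - p) * exp (- (k * p)) + p * exp r)
      by (unfold r; replace (k * (1 - p)) with (k + - (k * p)) by ring; rewrite exp_plus; ring).
    apply Rmult_le_compat_l with (r := p) in Hone; [|lra].
    apply Rmult_le_compat_l with (r := 1 - p) in Hzero; [|lra].
    apply Rle_trans with (1 := Rplus_le_compat _ _ _ _ Hzero Hone).
    right; unfold V, r in *; field; lra. }
  assert (Hmgf : 0 < 1 - p + p * exp k) by (assert (X := exp_pos k); nra).
  apply ln_le in centered_mgf_le as L; [|apply Rmult_lt_0_compat; [exact Hmgf|apply exp_pos]].
  rewrite ln_mult, !ln_exp in L by (exact Hmgf || apply exp_pos); unfold bernoulli_cgf; lra.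
Qed.

Lemma rank1_bernstein n us p D t P :
  Forall (fun u => sqnorm n u = 1) us -> 0 < p < 1 -> 0 < D -> 0 <= t ->
  (forall v, lsum us (fun u => dot n u v ^ 2) <= D * sqnorm n v) ->
  (forall zs, length zs = length us -> ~ P zs ->
     exists v, 0 < sqnorm n v /\ t * sqnorm n v <= deviation n us p zs v) ->
  1 - expectation p (length us) (indicator P) <=
  INR n * exp (- (t ^ 2 / (2 * (p * (1 - p) * D + (1 - p) * t / 3)))).
Proof.
  intros Hus Hp HD Ht Hframe HP; set (s := p * (1 - p) * D + (1 - p) * t / 3).
  assert (Hvar : 0 < p * (1 - p) * D) by (apply Rmult_lt_0_compat; nra).
  assert (Hs : 0 < s) by (unfold s; assert (0 <= (1 - p) * t) by nra; lra).
  assert (Hk : 0 <= t / s) by (apply Rdiv_le_0_compat; lra).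
  assert (Hr : 1 - t / s * (1 - p) / 3 = p * (1 - p) * D / s)
    by (replace (p * (1 - p) * D) with (s - (1 - p) * t / 3) by (unfold s; ring); field; lra).
  assert (Hr_pos : 0 < p * (1 - p) * D / s) by (apply Rdiv_lt_0_compat; auto).
  assert (B := bernoulli_cgf_bernstein p (t / s) Hp Hk ltac:(lra)); rewrite Hr in B.
  apply Rmult_le_compat_r with (r := D) in B; [|lra].
  assert (C := rank1_chernoff n us p D Hus Hp (Rlt_le _ _ HD) Hframe P (t / s) t Hk Ht HP).
  apply Rle_trans with (1 := C); apply Rmult_le_compat_l; [apply pos_INR|]; apply exp_le.
  replace (p * (1 - p) * (t / s) ^ 2 / 2 / (p * (1 - p) * D / s) * D)
    with (t ^ 2 / (2 * s)) in B by (field; nra).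
  replace (t / s * t) with (2 * (t ^ 2 / (2 * s))) by (field; lra); lra.
Qed.

(** * Signed Laplacians and dual certificates *)

Definition edge_energy (v : nat -> R) (e : nat * nat) : R := (v (fst e) - v (snd e)) ^ 2.

Definition noise_sign (z : bool) : R := if z then -1 else 1.

Definition proper_edge (n : nat) (e : nat * nat) : Prop :=
  (fst e < n)%nat /\ (snd e < n)%nat /\ fst e <> snd e.

Definition signed_laplacian (E : list (nat * nat)) (zs : list bool) (v : nat -> R) : R :=
  lsum (combine E zs) (fun q => noise_sign (snd q) * edge_energy v (fst q)).

Definition positive_off_constants (n : nat) (E : list (nat * nat)) (zs : list bool) : Prop :=
  forall v, rsum n v = 0 -> sqnorm n v <> 0 -> 0 < signed_laplacian E zs v.

Definition center (n : nat) (v : nat -> R) (i : nat) : R := v i - rsum n v / INR n.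

Lemma rsum_center n v : rsum n (center n v) = 0.
Proof.
  unfold center; rewrite rsum_minus, rsum_const.
  destruct n; [simpl; ring|]; field; apply not_0_INR; lia.
Qed.

Lemma sqnorm_center_le n v : sqnorm n (center n v) <= sqnorm n v.
Proof.
  set (m := rsum n v / INR n).
  assert (E : sqnorm n v = sqnorm n (center n v) + 2 * m * rsum n (center n v) + INR n * m ^ 2).
  { unfold sqnorm; rewrite <- rsum_const, <- rsum_scal, <- !rsum_plus.
    apply rsum_ext; intros; unfold center; fold m; ring. }
  rewrite rsum_center in E.
  assert (0 <= INR n * m ^ 2) by (apply Rmult_le_pos; [apply pos_INR|apply pow2_ge_0]); lra.
Qed.

Lemma edge_energy_center n v e : edge_energy (center n v) e = edge_energy v e.
Proof. unfold edge_energy, center; ring. Qed.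

Lemma signed_laplacian_center n E zs v :
  signed_laplacian E zs (center n v) = signed_laplacian E zs v.
Proof. apply lsum_ext; intros; rewrite edge_energy_center; reflexivity. Qed.

Lemma signed_laplacian_const n E zs v : Forall (proper_edge n) E ->
  (forall i j, (i < n)%nat -> (j < n)%nat -> v i = v j) -> signed_laplacian E zs v = 0.
Proof.
  intros HE Hv; apply lsum_eq0; intros [e z] He; apply in_combine_l in He.
  rewrite Forall_forall in HE; destruct (HE e He) as [H1 [H2 _]].
  unfold edge_energy; simpl fst; rewrite (Hv (fst e) (snd e)) by auto; ring.
Qed.

Lemma signed_laplacian_pos_or_const n E zs v : positive_off_constants n E zs ->
  0 < signed_laplacian E zs v \/ (forall i j, (i < n)%nat -> (j < n)%nat -> v i = v j).
Proof.
  intros Hpos; destruct (Req_dec (sqnorm n (center n v)) 0) as [Z|Z]; [right|left].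
  - intros i j Hi Hj; assert (Hc := sqnorm_eq0 n _ Z); unfold center in Hc.
    assert (Ci := Hc i Hi); assert (Cj := Hc j Hj); lra.
  - rewrite <- (signed_laplacian_center n); apply Hpos; [apply rsum_center|auto].
Qed.

Lemma signed_laplacian_nonneg n E zs v : Forall (proper_edge n) E ->
  positive_off_constants n E zs -> 0 <= signed_laplacian E zs v.
Proof.
  intros HE Hpos; destruct (signed_laplacian_pos_or_const n E zs v Hpos) as [|Hv]; [lra|].
  rewrite (signed_laplacian_const n) by auto; lra.
Qed.

Lemma gvec_sqr x i : gvec x i * gvec x i = 1.
Proof. unfold gvec; destruct (x i); ring. Qed.

Lemma W_of_cons u w E x z zs i j : u <> w ->
  W_of ((u, w) :: E) x (z :: zs) i j =
  gvec x u * gvec x w * noise_sign z * (unitv u i * unitv w j + unitv w i * unitv u j) +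
  W_of E x zs i j.
Proof.
  intros Huw; unfold W_of; simpl; set (acc := fold_right _ 0 _).
  replace (if xorb (xorb (x u) (x w)) z then -1 else 1)
    with (gvec x u * gvec x w * noise_sign z)
    by (unfold gvec, noise_sign; destruct (x u), (x w), z; simpl; ring).
  unfold unitv; rewrite (Nat.eqb_sym i u), (Nat.eqb_sym i w), (Nat.eqb_sym j u), (Nat.eqb_sym j w).
  destruct (Nat.eqb_spec u i), (Nat.eqb_spec w j), (Nat.eqb_spec u j), (Nat.eqb_spec w i);
    simpl; try ring; exfalso; lia.
Qed.

Lemma trace_prod_unitv n X u w : (u < n)%nat -> (w < n)%nat ->
  trace_prod n (fun i j => unitv u i * unitv w j) X = X w u.
Proof.
  intros Hu Hw; rewrite <- (dot_unitv n w (fun j => X j u)) by auto.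
  rewrite <- (dot_unitv n u (fun i => dot n (unitv w) (fun j => X j i))) by auto.
  unfold trace_prod, dot; apply rsum_ext; intros i _.
  rewrite <- rsum_scal; apply rsum_ext; intros; ring.
Qed.

Lemma trace_prod_linear n a A B X :
  trace_prod n (fun i j => a * A i j + B i j) X = a * trace_prod n A X + trace_prod n B X.
Proof.
  unfold trace_prod; rewrite <- rsum_scal, <- rsum_plus; apply rsum_ext; intros i _.
  rewrite <- rsum_scal, <- rsum_plus; apply rsum_ext; intros; ring.
Qed.

Lemma trace_prod_ext n A B X : (forall i j, A i j = B i j) -> trace_prod n A X = trace_prod n B X.
Proof. intros H; apply rsum_ext; intros; apply rsum_ext; intros; rewrite H; auto. Qed.

Lemma trace_prod_W_of n E x zs X : Forall (proper_edge n) E ->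
  trace_prod n (W_of E x zs) X =
  lsum (combine E zs) (fun q =>
    noise_sign (snd q) * (gvec x (fst (fst q)) * gvec x (snd (fst q))) *
    (X (fst (fst q)) (snd (fst q)) + X (snd (fst q)) (fst (fst q)))).
Proof.
  intros HE; revert zs; induction HE as [|[u w] E [Hu [Hw Huw]] HE IH]; intros [|z zs];
    try (apply rsum_eq0; intros; apply rsum_eq0; intros; apply Rmult_0_l).
  simpl in Hu, Hw, Huw; simpl combine; simpl lsum; rewrite <- IH.
  rewrite (trace_prod_ext n _ (fun i j => gvec x u * gvec x w * noise_sign z *
    (1 * (unitv u i * unitv w j) + unitv w i * unitv u j) + W_of E x zs i j))
    by (intros; rewrite W_of_cons by auto; ring).
  rewrite trace_prod_linear, (trace_prod_linear n 1), !trace_prod_unitv by auto; ring.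
Qed.

Lemma sdp_feasible_outer_gvec n x : sdp_feasible n (fun i j => gvec x i * gvec x j).
Proof.
  split; [intros; ring|split; [|intros; apply gvec_sqr]].
  intros v; rewrite quad_outer; apply pow2_ge_0.
Qed.

Section OptimalityGap.

Variables (n : nat) (E : list (nat * nat)) (x : nat -> bool).
Variables (X : nat -> nat -> R) (y : nat -> nat -> R).
Hypothesis E_proper : Forall (proper_edge n) E.
Hypothesis X_diag : forall i, (i < n)%nat -> X i i = 1.
Hypothesis X_gram : forall i j, (i < n)%nat -> (j < n)%nat ->
  X i j = rsum n (fun k => y k i * y k j).

Definition signed_gram_vector (k i : nat) : R := gvec x i * y k i.

Lemma signed_gram i j : (i < n)%nat -> (j < n)%nat ->
  rsum n (fun k => signed_gram_vector k i * signed_gram_vector k j) = gvec x i * gvec x j * X i j.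
Proof.
  intros Hi Hj; rewrite X_gram, <- rsum_scal by auto.
  apply rsum_ext; intros; unfold signed_gram_vector; ring.
Qed.

Lemma rsum_edge_energy_gram u w : (u < n)%nat -> (w < n)%nat ->
  rsum n (fun k => edge_energy (signed_gram_vector k) (u, w)) =
  2 - 2 * (gvec x u * gvec x w * X u w).
Proof.
  intros Hu Hw; rewrite <- signed_gram by auto.
  replace 2 with (gvec x u * gvec x u * X u u + gvec x w * gvec x w * X w w) at 1
    by (rewrite !gvec_sqr, !X_diag by auto; ring).
  rewrite <- !signed_gram, <- rsum_plus, <- rsum_scal, <- rsum_minus by auto.
  apply rsum_ext; intros; unfold edge_energy; simpl; ring.
Qed.

Lemma optimality_gap zs :
  trace_prod n (W_of E x zs) (fun i j => gvec x i * gvec x j) - trace_prod n (W_of E x zs) X =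
  rsum n (fun k => signed_laplacian E zs (signed_gram_vector k)).
Proof.
  unfold signed_laplacian; rewrite <- (lsum_rsum_swap (combine E zs) n
    (fun q k => noise_sign (snd q) * edge_energy (signed_gram_vector k) (fst q))).
  rewrite !trace_prod_W_of, <- lsum_minus by auto.
  apply lsum_ext; intros [[u w] z] He; apply in_combine_l in He.
  rewrite Forall_forall in E_proper; destruct (E_proper _ He) as [Hu [Hw _]]; simpl in *.
  rewrite rsum_scal, rsum_edge_energy_gram by auto.
  rewrite (X_gram w u), (rsum_ext n _ (fun k => y k u * y k w)), <- X_gram
    by (auto; intros; ring).
  transitivity (noise_sign z * (2 * ((gvec x u * gvec x u) * (gvec x w * gvec x w)) -
    2 * (gvec x u * gvec x w * X u w))); [ring|].
  rewrite !gvec_sqr; ring.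
Qed.

Lemma eq_outer_of_const_gram i j : (i < n)%nat -> (j < n)%nat ->
  (forall k, (k < n)%nat -> signed_gram_vector k i = signed_gram_vector k j) ->
  X i j = gvec x i * gvec x j.
Proof.
  intros Hi Hj Hconst.
  assert (H : gvec x i * gvec x j * X i j = 1).
  { rewrite <- signed_gram, <- (X_diag i), X_gram by auto.
    apply rsum_ext; intros k Hk; rewrite <- Hconst by auto; unfold signed_gram_vector.
    transitivity (gvec x i * gvec x i * (y k i * y k i)); [ring|rewrite gvec_sqr; ring]. }
  transitivity ((gvec x i * gvec x i) * (gvec x j * gvec x j) * X i j);
    [rewrite !gvec_sqr; ring|].
  transitivity (gvec x i * gvec x j * (gvec x i * gvec x j * X i j)); [ring|].
  rewrite H; ring.
Qed.

End OptimalityGap.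

Lemma positive_off_constants_unique_opt n E zs x :
  Forall (proper_edge n) E -> positive_off_constants n E zs ->
  sdp_unique_opt n (W_of E x zs) (fun i j => gvec x i * gvec x j).
Proof.
  intros HE Hpos; split; [apply sdp_feasible_outer_gvec|].
  intros X [Xsym [Xpsd Xdiag]].
  destruct (psd_gram n X (conj Xsym Xpsd)) as [y Hy].
  assert (gap := optimality_gap n E x X y HE Xdiag Hy zs).
  assert (gap_nonneg : forall k, (k < n)%nat ->
    0 <= signed_laplacian E zs (signed_gram_vector x y k))
    by (intros; apply (signed_laplacian_nonneg n); auto).
  split; [assert (G := rsum_nonneg n _ gap_nonneg); lra|].
  intros Heq i j Hi Hj; apply (eq_outer_of_const_gram n x X y); auto; intros k Hk.
  assert (gap_eq0 := rsum_nonneg_eq0 n _ gap_nonneg ltac:(lra) k Hk).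
  destruct (signed_laplacian_pos_or_const n E zs (signed_gram_vector x y k) Hpos); [lra|auto].
Qed.

(** * Laplacian of a regular graph *)

Definition laplacian_form (E : list (nat * nat)) (v : nat -> R) : R := lsum E (edge_energy v).

Lemma edges_proper n a : Forall (proper_edge n) (edges n a).
Proof.
  apply Forall_forall; intros [u v] H; unfold edges in H.
  apply filter_In in H as [H1 H2]; apply in_prod_iff in H1 as [H3 H4].
  apply in_seq in H3; apply in_seq in H4; simpl in *.
  apply andb_prop in H2 as [H2 _]; apply Nat.ltb_lt in H2.
  repeat split; simpl; lia.
Qed.

Lemma lsum_edges n a F :
  lsum (edges n a) F =
  rsum n (fun i => rsum n (fun j => if andb (Nat.ltb i j) (a i j) then F (i, j) else 0)).
Proof.
  unfold edges; rewrite lsum_filter, lsum_list_prod, rsum_lsum.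
  apply lsum_ext; intros; rewrite rsum_lsum; reflexivity.
Qed.

Lemma lsum_edges_sym n a F :
  (forall i j, a i j = a j i) -> (forall i, a i i = false) -> (forall i j, F (i, j) = F (j, i)) ->
  2 * lsum (edges n a) F = rsum n (fun i => rsum n (fun j => adjR a i j * F (i, j))).
Proof.
  intros Hsym Hirr HF; rewrite lsum_edges.
  match goal with |- 2 * ?s = _ => replace (2 * s) with (s + s) by ring end.
  rewrite (rsum_swap n n) at 2; rewrite <- rsum_plus; apply rsum_ext; intros i _.
  rewrite <- rsum_plus; apply rsum_ext; intros j _; unfold adjR.
  rewrite (Hsym j i), (HF j i); destruct (Nat.eq_dec i j) as [->|Hij].
  - rewrite Hirr, Bool.andb_false_r; ring.
  - destruct (a i j), (Nat.ltb_spec i j), (Nat.ltb_spec j i); simpl; try ring; lia.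
Qed.

Lemma rsum_adjR n d a i : simple_regular n d a -> (i < n)%nat -> rsum n (adjR a i) = INR d.
Proof.
  intros [_ [_ [_ Hreg]]] Hi; rewrite <- (Hreg i Hi), rsum_lsum.
  rewrite <- (Rmult_1_r (INR _)), <- lsum_const, lsum_filter; reflexivity.
Qed.

Lemma laplacian_form_regular n d a v : simple_regular n d a ->
  laplacian_form (edges n a) v = INR d * sqnorm n v - quad n (adjR a) v.
Proof.
  intros Hreg; assert (Hsym := proj1 Hreg); assert (Hirr := proj1 (proj2 Hreg)).
  apply Rmult_eq_reg_l with 2; [|lra].
  unfold laplacian_form; rewrite lsum_edges_sym by (auto; intros; unfold edge_energy; simpl; ring).
  assert (degree_sum :
    rsum n (fun i => rsum n (fun j => v i ^ 2 * adjR a i j)) = INR d * sqnorm n v).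
  { unfold sqnorm; rewrite <- rsum_scal; apply rsum_ext; intros i Hi.
    rewrite rsum_scal, (rsum_adjR n d) by auto; ring. }
  transitivity (rsum n (fun i => rsum n (fun j => v i ^ 2 * adjR a i j)) +
    rsum n (fun i => rsum n (fun j => v j ^ 2 * adjR a j i)) + (-2) * quad n (adjR a) v).
  - unfold quad; rewrite <- rsum_scal, <- !rsum_plus; apply rsum_ext; intros i _.
    rewrite <- rsum_scal, <- !rsum_plus; apply rsum_ext; intros j _.
    unfold edge_energy, adjR; simpl; rewrite (Hsym j i); ring.
  - rewrite (rsum_swap n n (fun i j => v j ^ 2 * adjR a j i)), degree_sum; ring.
Qed.

(* [s = 1] bounds the spectrum off the constants from above, [s = -1] from below. *)
Lemma rayleigh_bound n d a s l v : (0 < d)%nat ->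
  (forall r, rayleigh_set n d a r -> s * r <= l) -> rsum n v = 0 ->
  s * quad n (adjR a) v <= INR d * l * sqnorm n v.
Proof.
  intros Hd Hl Hv; apply lt_0_INR in Hd.
  destruct (Req_dec (sqnorm n v) 0) as [Z|Z].
  - assert (Hv0 := sqnorm_eq0 n v Z).
    replace (quad n (adjR a) v) with 0; [rewrite Z; lra|].
    symmetry; apply rsum_eq0; intros i Hi; apply rsum_eq0; intros; rewrite (Hv0 i) by auto; ring.
  - assert (N := sqnorm_nonneg n v).
    assert (B := Hl _ (ex_intro _ v (conj Hv (conj Z eq_refl)))).
    apply Rmult_le_compat_l with (r := INR d * sqnorm n v) in B; [|nra].
    replace (INR d * sqnorm n v * (s * (/ INR d * (quad n (adjR a) v / sqnorm n v))))
      with (s * quad n (adjR a) v) in B by (field; lra).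
    lra.
Qed.

Lemma laplacian_form_lower n d a l v : simple_regular n d a -> (0 < d)%nat ->
  is_lambda2 n d a l -> rsum n v = 0 ->
  INR d * (1 - l) * sqnorm n v <= laplacian_form (edges n a) v.
Proof.
  intros Hreg Hd [_ Hl] Hv; rewrite (laplacian_form_regular n d) by auto.
  assert (B : 1 * quad n (adjR a) v <= INR d * l * sqnorm n v); [|lra].
  apply rayleigh_bound; auto; intros r Hr; rewrite Rmult_1_l; auto.
Qed.

Lemma laplacian_form_upper n d a l v : simple_regular n d a -> (0 < d)%nat ->
  is_abs_lambdan n d a l -> 0 <= 1 + l ->
  laplacian_form (edges n a) v <= INR d * (1 + l) * sqnorm n v.
Proof.
  intros Hreg Hd [_ Hl] Hl1.
  replace (laplacian_form (edges n a) v) with (laplacian_form (edges n a) (center n v))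
    by (apply lsum_ext; intros; apply edge_energy_center).
  apply Rle_trans with (INR d * (1 + l) * sqnorm n (center n v)).
  - rewrite (laplacian_form_regular n d) by auto.
    assert (B : -1 * quad n (adjR a) (center n v) <= INR d * l * sqnorm n (center n v)); [|lra].
    apply rayleigh_bound; auto; [|apply rsum_center].
    intros r Hr; apply Hl; replace (- (-1 * r)) with r by ring; auto.
  - apply Rmult_le_compat_l, sqnorm_center_le; apply Rmult_le_pos; [apply pos_INR|auto].
Qed.

(** * Exact recovery *)

Definition edge_vec (e : nat * nat) (i : nat) : R := (unitv (fst e) i - unitv (snd e) i) / sqrt 2.

Lemma dot_edge_vec n e v : proper_edge n e ->
  dot n (edge_vec e) v = (v (fst e) - v (snd e)) / sqrt 2.
Proof.
  intros [H1 [H2 _]]; rewrite <- (dot_unitv n (fst e) v), <- (dot_unitv n (snd e) v) by auto.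
  unfold Rdiv, dot; rewrite <- rsum_minus, <- rsum_scal_r; apply rsum_ext; intros.
  unfold edge_vec; unfold Rdiv; ring.
Qed.

Lemma dot_edge_vec_sqr n e v : proper_edge n e -> dot n (edge_vec e) v ^ 2 = edge_energy v e / 2.
Proof.
  intros He; rewrite dot_edge_vec by auto; unfold edge_energy, Rdiv.
  rewrite Rpow_mult_distr, pow_inv, pow2_sqrt by lra; reflexivity.
Qed.

Lemma sqnorm_edge_vec n e : proper_edge n e -> sqnorm n (edge_vec e) = 1.
Proof.
  intros He; rewrite sqnorm_dot, dot_edge_vec by auto; unfold edge_vec, unitv.
  rewrite !Nat.eqb_refl; destruct He as [_ [_ He]].
  destruct (Nat.eqb_spec (fst e) (snd e)), (Nat.eqb_spec (snd e) (fst e)); try lia.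
  unfold Rdiv; rewrite <- Rmult_minus_distr_r, Rmult_assoc, <- Rinv_mult, sqrt_sqrt by lra; lra.
Qed.

Lemma lsum_edge_vec n E v : Forall (proper_edge n) E ->
  lsum (map edge_vec E) (fun u => dot n u v ^ 2) = laplacian_form E v / 2.
Proof.
  intros HE; rewrite Forall_forall in HE; rewrite lsum_map; unfold laplacian_form, Rdiv.
  rewrite Rmult_comm, <- lsum_scal; apply lsum_ext; intros e He.
  rewrite dot_edge_vec_sqr by auto; lra.
Qed.

Lemma deviation_edge_vec n E p zs v : Forall (proper_edge n) E -> length zs = length E ->
  deviation n (map edge_vec E) p zs v =
  (1 - 2 * p) / 4 * laplacian_form E v - signed_laplacian E zs v / 4.
Proof.
  intros HE Hz; rewrite Forall_forall in HE.
  unfold deviation, laplacian_form, signed_laplacian.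
  rewrite <- (lsum_combine_fst E zs) by auto.
  replace (lsum (combine E zs) _ / 4) with
    (/ 4 * lsum (combine E zs) (fun q => noise_sign (snd q) * edge_energy v (fst q))) by field.
  rewrite <- !lsum_scal, <- lsum_minus, lsum_combine_map_l.
  apply lsum_ext; intros [e z] He; apply in_combine_l in He; simpl fst; simpl snd.
  rewrite dot_edge_vec_sqr by auto; destruct z; simpl; field.
Qed.

Lemma spectral_gap_failure_bound n E p D D' :
  Forall (proper_edge n) E -> 0 < p < 1 / 2 -> 0 < D -> 0 <= D' ->
  (forall v, laplacian_form E v <= D * sqnorm n v) ->
  (forall v, rsum n v = 0 -> D' * sqnorm n v <= laplacian_form E v) ->
  forall P, (forall zs, positive_off_constants n E zs -> P zs) ->
  1 - expectation p (length E) (indicator P) <=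
  INR n * exp (- (((1 - 2 * p) * D' / 4) ^ 2 /
    (2 * (p * (1 - p) * (D / 2) + (1 - p) * ((1 - 2 * p) * D' / 4) / 3)))).
Proof.
  intros HE Hp HD HD' Hupper Hlower P HP; rewrite <- (length_map edge_vec E).
  apply rank1_bernstein; [|lra|lra|nra| |].
  - apply Forall_map; revert HE; apply Forall_impl; intros e He; apply sqnorm_edge_vec; auto.
  - intros v; rewrite lsum_edge_vec by auto; specialize (Hupper v); lra.
  - intros zs Hz Hn; rewrite length_map in Hz.
    assert (Hnot : ~ positive_off_constants n E zs) by auto.
    apply not_all_ex_not in Hnot as [v Hv].
    apply imply_to_and in Hv as [Hv0 Hv]; apply imply_to_and in Hv as [Hvn Hv].
    exists v; assert (N := sqnorm_nonneg n v); split; [lra|].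
    rewrite deviation_edge_vec by auto; specialize (Hlower v Hv0); nra.
Qed.

Lemma rayleigh_set_dim_ge2 n d a r : rayleigh_set n d a r -> (2 <= n)%nat.
Proof.
  intros [v [Hv [Hn _]]]; unfold sqnorm in Hn.
  destruct n as [|[|n]]; [| |lia]; exfalso; apply Hn; simpl in *; nra.
Qed.

Lemma degree_condition_exponent d L lam2 lamn eps delta :
  0 < L -> 0 < 1 + lamn -> lam2 < 1 -> 0 < eps < 1 / 2 -> 0 < delta ->
  d / L >= 4 * (1 + lamn) / (1 - lam2) ^ 2 * (1 + delta) *
    (1 / (1 - 2 * eps) ^ 2
     + 1 / 3 * (1 - lam2) / ((1 - 2 * eps) * (1 + lamn))
     + 1 / 3 * (1 - lam2) / (1 + lamn) - 1) ->
  0 < d /\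
  (1 + delta) * L <=
  ((1 - 2 * eps) * (d * (1 - lam2)) / 4) ^ 2 /
    (2 * (eps * (1 - eps) * (d * (1 + lamn) / 2) +
          (1 - eps) * ((1 - 2 * eps) * (d * (1 - lam2)) / 4) / 3)).
Proof.
  intros HL Hlamn Hlam2 Heps Hdelta Hcond.
  (* The hypothesis reads [d / L >= (1 + delta) * theta] and the exponent is [d / theta],
     for [theta = 4 s / t ^ 2]. *)
  set (t := (1 - 2 * eps) * (1 - lam2)).
  set (s := 4 * eps * (1 - eps) * (1 + lamn) + 2 / 3 * (1 - eps) * t).
  assert (Ht : 0 < t) by (apply Rmult_lt_0_compat; lra).
  assert (Hs : 0 < s).
  { assert (0 < eps * (1 - eps) * (1 + lamn)) by (apply Rmult_lt_0_compat; nra).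
    assert (0 < (1 - eps) * t) by nra; unfold s; lra. }
  match type of Hcond with _ >= ?r =>
    replace r with ((1 + delta) * (4 * s / t ^ 2)) in Hcond
      by (unfold s, t; field; repeat split; lra)
  end.
  assert (Hd : (1 + delta) * L * (4 * s / t ^ 2) <= d).
  { apply Rge_le, Rmult_le_compat_r with (r := L) in Hcond; [|lra].
    replace (d / L * L) with d in Hcond by (field; lra); lra. }
  assert (Hthreshold : 0 < 4 * s / t ^ 2) by (apply Rdiv_lt_0_compat; nra).
  assert (Hd0 : 0 < d) by (apply Rlt_le_trans with (2 := Hd); apply Rmult_lt_0_compat; nra).
  split; [exact Hd0|].
  match goal with |- _ <= ?r => replace r with (d / (4 * s / t ^ 2)) end.
  - apply Rmult_le_reg_r with (4 * s / t ^ 2); [auto|].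
    replace (d / (4 * s / t ^ 2) * (4 * s / t ^ 2)) with d by (field; nra); exact Hd.
  - fold t.
    replace ((1 - 2 * eps) * (d * (1 - lam2))) with (d * t) by (unfold t; ring).
    replace (eps * (1 - eps) * (d * (1 + lamn) / 2) + (1 - eps) * (d * t / 4) / 3)
      with (d * s / 8) by (unfold s; field).
    field; nra.
Qed.

Theorem theorem5 (n d : nat) (a : nat -> nat -> bool) (x : nat -> bool)
  (lam2 lamn_abs eps delta : R) :
  simple_regular n d a ->
  is_lambda2 n d a lam2 ->
  is_abs_lambdan n d a lamn_abs ->
  lam2 < 1 ->
  0 < eps < 1 / 2 ->
  0 < delta ->
  INR d / ln (INR n) >=
    4 * (1 + lamn_abs) / (1 - lam2) ^ 2 * (1 + delta) *
    (1 / (1 - 2 * eps) ^ 2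
     + 1 / 3 * (1 - lam2) / ((1 - 2 * eps) * (1 + lamn_abs))
     + 1 / 3 * (1 - lam2) / (1 + lamn_abs) - 1) ->
  prob n a eps
    (fun zs => sdp_unique_opt n (W_of (edges n a) x zs)
                 (fun i j => gvec x i * gvec x j))
  >= 1 - Rpower (INR n) (- delta).
Proof.
  intros Hreg Hlam2 Hlamn Hgap Heps Hdelta Hcond.
  assert (Hn : (2 <= n)%nat) by (apply (rayleigh_set_dim_ge2 n d a lam2), Hlam2).
  apply le_INR in Hn; simpl in Hn.
  assert (Hln : 0 < ln (INR n)) by (rewrite <- ln_1; apply ln_increasing; lra).
  assert (Hlamn_lam2 : - lam2 <= lamn_abs)
    by (apply Hlamn; simpl; rewrite Ropp_involutive; apply Hlam2).
  destruct (degree_condition_exponent (INR d) (ln (INR n)) lam2 lamn_abs eps delta)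
    as [Hd Hexponent]; auto; [lra|].
  assert (Hd_nat : (0 < d)%nat) by (apply INR_lt; auto).
  assert (Hfail := spectral_gap_failure_bound n (edges n a) eps
    (INR d * (1 + lamn_abs)) (INR d * (1 - lam2)) (edges_proper n a) Heps ltac:(nra) ltac:(nra)
    (fun v => laplacian_form_upper n d a lamn_abs v Hreg Hd_nat Hlamn ltac:(lra))
    (fun v => laplacian_form_lower n d a lam2 v Hreg Hd_nat Hlam2)
    _ (fun zs => positive_off_constants_unique_opt n (edges n a) zs x (edges_proper n a))).
  rewrite <- prob_expectation in Hfail.
  rewrite <- (exp_ln (INR n)) in Hfail at 1 by lra; rewrite <- exp_plus in Hfail.
  set (q := prob _ _ _ _) in *.
  assert (1 - q <= Rpower (INR n) (- delta)) by (apply Rle_trans with (1 := Hfail), exp_le; lra).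
  lra.
Qed.
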